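(* Suppose that $G\in\mathcal{P}$ (i.e. $G$ is a finite product of groups of the form $SU(r)$, $U(q)$, $Sp(k)$), let $T\subset G$ be a maximal torus and $W=N_G(T)/T$ the Weyl group. Let $\pi$ be a finitely generated abelian group written in the form $\pi=\mathbb{Z}^n\oplus A$, where $A$ is a finite abelian group. Then the number of path-connected components in $\operatorname{Hom}(\pi,G)$ equals the number of different orbits of the action of $W$ on $\operatorname{Hom}(A,T)$.
   Context: $\operatorname{Hom}(\pi,G)$ has the subspace topology from $\operatorname{Hom}(\pi,G)\hookrightarrow G^m$ given by evaluating on a finite generating set of $\pi$ with $m$ elements. $W$ acts on $\operatorname{Hom}(A,T)$ through its conjugation action on $T$. *)

(* Defs.v *)
From HB Require Import structures.
From mathcomp Require Import all_boot all_order all_algebra.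
From mathcomp Require Import spectral sesquilinear complex.
From mathcomp Require Import all_classical all_reals all_analysis.

Set Implicit Arguments.
Unset Strict Implicit.
Unset Printing Implicit Defensive.

Import Order.TTheory GRing.Theory Num.Theory.
Import numFieldNormedType.Exports.

Local Open Scope classical_set_scope.
Local Open Scope ring_scope.
Local Open Scope sesquilinear_scope.

HB.mixin Record isTopologicalGroup G & Topological G & Group G := {
  mulg_continuous : continuous (fun x : G * G => (x.1 * x.2)%g);
  invg_continuous : continuous (fun x : G => x^-1%g)
}.

#[short(type="topologicalGroupType")]
HB.structure Definition TopologicalGroup :=
  {G of isTopologicalGroup G & Topological G & Group G}.

Variant classical_type := FactorSU of nat | FactorU of nat | FactorSp of nat.

Definition degree (c : classical_type) : nat :=
  match c with FactorSU r => r | FactorU q => q | FactorSp k => k + k end.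

Lemma cvg_mx (S : Type) (F : set_system S) (FF : Filter F)
    (T : topologicalType) m n (f : S -> 'M[T]_(m, n)) (M : 'M[T]_(m, n)) :
  (forall i j, (fun s => f s i j) @ F --> M i j) -> f @ F --> M.
Proof.
move=> fM A [P MP PA].
  apply: (@filterS _ F _ (fun s => forall i j, P i j (f s i j))).
  by move=> s; exact: PA.
by apply: filter_forall => i; apply: filter_forall => j; exact: fM.
Qed.

Lemma conjC_continuous (C : numClosedFieldType) :
  continuous (Num.conj : C -> C).
Proof.
move=> x A /nbhs_ballP[e /= e0 xeA]; apply/nbhs_ballP; exists e => //= y xey.
by apply: xeA; move: xey; rewrite -!ball_normE /= -rmorphB norm_conjC.
Qed.

Section ClassicalGroups.
Variable C : numClosedFieldType.

Definition sympl_form k : 'M[C]_(k + k) := block_mx 0 1%:M (- 1%:M) 0.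

(* FactorSp k is the compact symplectic group, in its complex matrix form
   U(2k) `&` Sp(2k, C): the image of the quaternionic unitary matrices under
   the embedding A + B j |-> block_mx A B (- conj B) (conj A). *)
Definition factor_pred (c : classical_type) : pred 'M[C]_(degree c) :=
  match c return pred 'M[C]_(degree c) with
  | FactorSU r => fun M => (M \is unitarymx) && (\det M == 1)
  | FactorU q => fun M => M \is unitarymx
  | FactorSp k => fun M =>
      (M \is unitarymx) && (M^T *m sympl_form k *m M == sympl_form k)
  end.

Record factor_grp (c : classical_type) :=
  FactorGrp { factor_mx :> 'M[C]_(degree c); _ : factor_pred factor_mx }.

Section Group.
Variable c : classical_type.

HB.instance Definition _ := [isSub for @factor_mx c].
HB.instance Definition _ := [Choice of factor_grp c by <:].

Lemma factor_unitary (M : factor_grp c) : factor_mx M \is unitarymx.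
Proof. by case: M => M /=; case: c M => n M //= /andP[]. Qed.

Fact factor_pred1 : factor_pred (1%:M : 'M[C]_(degree c)).
Proof.
have u1 n : (1%:M : 'M[C]_n) \is unitarymx.
  by apply/unitarymxP; rewrite trmx1 map_mx1 mulmx1.
by case: c => n /=; rewrite u1 ?det1 ?trmx1 ?mul1mx ?mulmx1 /=.
Qed.

Fact factor_predM (M N : factor_grp c) :
  factor_pred (factor_mx M *m factor_mx N).
Proof.
case: M N => M + [N] /=; case: c M N => n M N /=.
- move=> /andP[uM /eqP dM] /andP[uN /eqP dN].
  by rewrite mul_unitarymx //= det_mulmx dM dN mulr1.
- exact: mul_unitarymx.
- move=> /andP[uM /eqP sM] /andP[uN /eqP sN]; rewrite mul_unitarymx //=.
  by apply/eqP; rewrite trmx_mul -[RHS]sN -[in RHS]sM !mulmxA.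
Qed.

Fact factor_predV (M : factor_grp c) : factor_pred ((factor_mx M) ^t*).
Proof.
case: M => M /=; case: c M => n M /=.
- move=> /andP[uM /eqP dM]; rewrite trmxC_unitary uM det_map_mx det_tr dM.
  by rewrite rmorph1 /=.
- by rewrite trmxC_unitary.
- move=> /andP[uM /eqP sM]; rewrite trmxC_unitary uM /=.
  have MV : M *m M ^t* = 1%:M by apply/unitarymxP.
  have VM : M ^t* *m M = 1%:M by apply: mulmx1C.
  have MVT : (M ^t*)^T *m M^T = 1%:M by rewrite -trmx_mul MV trmx1.
  by rewrite -[X in _ *m X *m _]sM !mulmxA MVT mul1mx -mulmxA MV mulmx1.
Qed.

Definition factor_one := FactorGrp factor_pred1.
Definition factor_mul (M N : factor_grp c) := FactorGrp (factor_predM M N).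
Definition factor_inv (M : factor_grp c) := FactorGrp (factor_predV M).

Fact factor_mulA : associative factor_mul.
Proof. by move=> x y z; apply: val_inj; rewrite /= mulmxA. Qed.
Fact factor_mul1 : left_id factor_one factor_mul.
Proof. by move=> x; apply: val_inj; rewrite /= mul1mx. Qed.
Fact factor_1mul : right_id factor_one factor_mul.
Proof. by move=> x; apply: val_inj; rewrite /= mulmx1. Qed.
Fact factor_mulxV : right_inverse factor_one factor_inv factor_mul.
Proof.
by move=> x; apply: val_inj; apply/unitarymxP; exact: factor_unitary.
Qed.
Fact factor_mulVx : left_inverse factor_one factor_inv factor_mul.
Proof.
move=> x; apply: val_inj; apply: mulmx1C; apply/unitarymxP.
exact: factor_unitary.
Qed.

HB.instance Definition _ := isGroup.Build (factor_grp c)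
  factor_mulA factor_mul1 factor_1mul factor_mulVx factor_mulxV.

HB.instance Definition _ :=
  Topological.copy (factor_grp c) (initial_topology (@factor_mx c)).

Fact factor_entry_continuous i j : continuous (fun M : factor_grp c => M i j).
Proof.
move=> M; apply: (@continuous_comp _ _ _ (@factor_mx c) (fun A => A i j)).
  exact: initial_continuous.
exact: coord_continuous.
Qed.

Fact factor_mulg_continuous :
  continuous (fun x : factor_grp c * factor_grp c => (x.1 * x.2)%g).
Proof.
apply: continuous_comp_initial => -[M N]; apply: cvg_mx => i j /=.
under eq_cvg do rewrite mxE; rewrite mxE.
apply: (cvg_big add_continuous) => l _; apply: cvgM.
  apply: (@continuous_comp _ _ _ fst (fun A : factor_grp c => A i l) (M, N)).
    exact: cvg_fst.
  exact: factor_entry_continuous.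
apply: (@continuous_comp _ _ _ snd (fun A : factor_grp c => A l j) (M, N)).
  exact: cvg_snd.
exact: factor_entry_continuous.
Qed.

Fact factor_invg_continuous : continuous (fun x : factor_grp c => x^-1%g).
Proof.
apply: continuous_comp_initial => M.
apply: (cvg_mx (nbhs_filter (M : factor_grp c))) => i j /=.
under eq_cvg do rewrite !mxE; rewrite !mxE.
apply: (@continuous_comp _ _ _ (fun A : factor_grp c => A j i) Num.conj M).
  exact: factor_entry_continuous.
exact: conjC_continuous.
Qed.

HB.instance Definition _ := isTopologicalGroup.Build (factor_grp c)
  factor_mulg_continuous factor_invg_continuous.

End Group.
End ClassicalGroups.

Section ProductGroup.
Variables (I : finType) (G : I -> topologicalGroupType).

Definition prod_group : Type := forall i, G i.

HB.instance Definition _ := gen_eqMixin prod_group.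
HB.instance Definition _ := gen_choiceMixin prod_group.

Definition prod_group_one : prod_group := fun i => 1%g.
Definition prod_group_mul (x y : prod_group) : prod_group :=
  fun i => (x i * y i)%g.
Definition prod_group_inv (x : prod_group) : prod_group := fun i => (x i)^-1%g.

Fact prod_group_mulA : associative prod_group_mul.
Proof.
by move=> x y z; apply/functional_extensionality_dep => i; exact: mulgA.
Qed.
Fact prod_group_mul1 : left_id prod_group_one prod_group_mul.
Proof. by move=> x; apply/functional_extensionality_dep => i; exact: mul1g. Qed.
Fact prod_group_1mul : right_id prod_group_one prod_group_mul.
Proof. by move=> x; apply/functional_extensionality_dep => i; exact: mulg1. Qed.
Fact prod_group_mulVx :
  left_inverse prod_group_one prod_group_inv prod_group_mul.
Proof. by move=> x; apply/functional_extensionality_dep => i; exact: mulVg. Qed.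
Fact prod_group_mulxV :
  right_inverse prod_group_one prod_group_inv prod_group_mul.
Proof. by move=> x; apply/functional_extensionality_dep => i; exact: mulgV. Qed.

HB.instance Definition _ := isGroup.Build prod_group
  prod_group_mulA prod_group_mul1 prod_group_1mul
  prod_group_mulVx prod_group_mulxV.
HB.instance Definition _ := Topological.copy prod_group (prod_topology G).

Fact prod_group_continuous (S : topologicalType) (f : S -> prod_group) :
  (forall i, continuous (fun s => f s i)) -> continuous f.
Proof.
move=> cf s; apply/cvg_sup => i A [_ [[B oB <-] /= Bfs BA]].
rewrite nbhs_filterE; apply: filterS BA _.
by apply: (cf i); exact: open_nbhs_nbhs.
Qed.

Fact prod_group_proj_continuous i : continuous (fun x : prod_group => x i).
Proof. exact: (@proj_continuous I G i). Qed.

Fact prod_group_mulg_continuous :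
  continuous (fun x : prod_group * prod_group => (x.1 * x.2)%g).
Proof.
apply: prod_group_continuous => i -[x y] /=.
apply: (@continuous_comp _ _ _
  (fun z : prod_group * prod_group => (z.1 i, z.2 i))
  (fun p : G i * G i => (p.1 * p.2)%g) (x, y)); last exact: mulg_continuous.
apply: cvg_pair => /=.
  apply: (@continuous_comp _ _ _ fst (fun z : prod_group => z i) (x, y)).
    exact: cvg_fst.
  exact: prod_group_proj_continuous.
apply: (@continuous_comp _ _ _ snd (fun z : prod_group => z i) (x, y)).
  exact: cvg_snd.
exact: prod_group_proj_continuous.
Qed.

Fact prod_group_invg_continuous : continuous (fun x : prod_group => x^-1%g).
Proof.
apply: prod_group_continuous => i x.
apply: (@continuous_comp _ _ _ (fun z : prod_group => z i)
  (fun u : G i => u^-1%g) x).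
  exact: prod_group_proj_continuous.
exact: invg_continuous.
Qed.

HB.instance Definition _ := isTopologicalGroup.Build prod_group
  prod_group_mulg_continuous prod_group_invg_continuous.

End ProductGroup.

Definition classical_product (C : numClosedFieldType) (I : finType)
  (F : I -> classical_type) := prod_group (fun i => factor_grp C (F i)).

HB.instance Definition _ (C : numClosedFieldType) (I : finType)
  (F : I -> classical_type) := TopologicalGroup.on (classical_product C F).

Section Torus.
Variables (C : numClosedFieldType) (G : topologicalGroupType).

Definition circle_power k :=
  prod_group (fun _ : 'I_k => factor_grp C (FactorU 1)).

(* A torus is the image of an isomorphism of topological groups from a power
   of the circle group U(1) onto a subgroup of G with the subspace topology. *)
Definition is_torus (T : set G) :=
  exists k (phi : circle_power k -> G) (psi : G -> circle_power k),
    [/\ (forall x y, phi (x * y)%g = (phi x * phi y)%g),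
        range phi = T,
        cancel phi psi,
        continuous phi &
        {within T, continuous psi}].

Definition maximal_torus (T : set G) :=
  is_torus T /\ (forall T' : set G, is_torus T' -> T `<=` T' -> T' = T).

End Torus.

Section Hom.
Variables (pi : zmodType) (G : topologicalGroupType).

(* Group homomorphisms from an additively written abelian group to a
   multiplicatively written group. *)
Record hom := Hom {
  hom_fun :> pi -> G;
  homD : forall x y, hom_fun (x + y) = (hom_fun x * hom_fun y)%g
}.

HB.instance Definition _ := gen_eqMixin hom.
HB.instance Definition _ := gen_choiceMixin hom.

Definition generates m (s : 'I_m -> pi) :=
  forall x, exists c : 'I_m -> int, x = \sum_i s i *~ c i.

Definition hom_eval m (s : 'I_m -> pi) (f : hom) :
  prod_topology (fun _ : 'I_m => G) := fun i => f (s i).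

Definition hom_space m (s : 'I_m -> pi) : topologicalType :=
  initial_topology (hom_eval s).

End Hom.

Section PathComponents.
Variables (R : realType) (X : topologicalType).

Definition path_joined (x y : X) := exists gamma : R -> X,
  [/\ {within `[0, 1], continuous gamma}, gamma 0 = x & gamma 1 = y].

Definition path_component (x : X) : set X := [set y | path_joined x y].

Definition path_components : set (set X) := range path_component.

End PathComponents.

Arguments path_components R X : clear implicits.

Section Weyl.
Variables (G : topologicalGroupType) (T : set G).

Definition conjs (g : G) : set G := [set (g * t * g^-1)%g | t in T].
Definition normaliser : set G := [set g | conjs g = T].
Definition lcoset (g : G) : set G := [set (g * t)%g | t in T].

(* N_G(T) / T as the set of left cosets of T in its normaliser. *)
Definition weyl_group : set (set G) := [set lcoset g | g in normaliser].

Variable A : zmodType.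

Fact conj_homD (g : G) (f : hom A G) (x y : A) :
  (g * f (x + y)%R * g^-1 = (g * f x * g^-1) * (g * f y * g^-1))%g.
Proof. by rewrite homD !mulgA mulgVK. Qed.

Definition conj_hom (g : G) (f : hom A G) : hom A G := Hom (conj_homD g f).

(* Hom(A, T), as the homomorphisms to G with values in T. *)
Definition hom_into : set (hom A G) := [set f | forall a, T (f a)].

(* A coset w acts by conjugation by any of its elements: see weyl_actE. *)
Definition weyl_act (w : set G) (f : hom A G) : hom A G :=
  conj_hom (xget 1%g w) f.

Definition weyl_orbit (f : hom A G) : set (hom A G) :=
  [set weyl_act w f | w in weyl_group].

Definition weyl_orbits : set (set (hom A G)) :=
  [set weyl_orbit f | f in hom_into].

Lemma hom_eq (f g : hom A G) : f =1 g -> f = g.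
Proof.
case: f g => f fD [g gD] /= /funext fg; case: _ / fg in gD *.
by congr Hom; exact: Prop_irrelevance.
Qed.

End Weyl.

Arguments weyl_orbits {G} T A.

Lemma torus_abelian (C : numClosedFieldType) (G : topologicalGroupType)
  (T : set G) (x y : G) : is_torus C T -> T x -> T y -> (x * y = y * x)%g.
Proof.
move=> [k [phi [psi [phiM <- _ _ _]]]] [u _ <-] [v _ <-]; rewrite -!phiM.
congr (phi _); apply: functional_extensionality_dep => i; apply: val_inj => /=.
by rewrite -[LHS]/(factor_mx (u i) *m factor_mx (v i))
  [factor_mx (u i)]mx11_scalar [factor_mx (v i)]mx11_scalar -!scalar_mxM mulrC.
Qed.

Lemma weyl_actE (C : numClosedFieldType) (G : topologicalGroupType)
    (T : set G) (A : zmodType) (g : G) (f : hom A G) :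
  is_torus C T -> hom_into T f -> weyl_act (lcoset T g) f = conj_hom g f.
Proof.
move=> torT Tf; apply: hom_eq => a /=; case: xgetP => [y -> [t Tt <-]|].
  rewrite invgM -!mulgA; congr (_ * _)%g; rewrite !mulgA.
  by rewrite (torus_abelian torT Tt (Tf a)) mulgK.
by move=> /(_ g)[]; case: torT => k [phi [psi [phiM <- _ _ _]]];
  exists 1%g; rewrite ?mulg1//; exists 1%g => //;
  apply: (mulgI (phi 1%g)); rewrite -phiM !mulg1.
Qed.

Lemma weyl_act_into (C : numClosedFieldType) (G : topologicalGroupType)
    (T : set G) (A : zmodType) (w : set G) (f : hom A G) :
  is_torus C T -> weyl_group T w -> hom_into T f -> hom_into T (weyl_act w f).
Proof.
move=> torT [g gT <-] Tf; rewrite (weyl_actE _ torT Tf) => a.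
by rewrite -[X in X _]gT; exists (f a).
Qed.

(* Main.v *)
(* Any commuting family in a factor SU(r), U(q) or Sp(k) can be diagonalised by
   an element of that factor, so every commuting family in G is conjugate into
   the diagonal torus D, and by maximality T is itself a conjugate of D. A
   homomorphism F from Z^n + A to G therefore has a conjugate with values in T;
   G is path connected, and in T the restriction of F to Z^n lifts to real
   angles that can be scaled down to 0, so F lies in the component of a
   homomorphism A -> T.
   Conversely, let f, f' : A -> D be joined by a path f_t in Hom(A, G). On each
   factor the multiplicity |A|^-1 * sum_a conj (x a) * tr (f_t a) of a character
   x of A is continuous in t and a natural number, hence constant. So f and f'
   have the same characters on the diagonal, up to order, and a monomial matrix,
   normalising D, conjugates one into the other. *)
From mathcomp Require Import fingroup perm.
From mathcomp Require Import all_boot all_order all_algebra.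
From mathcomp Require Import spectral sesquilinear complex lra.
From mathcomp Require Import all_classical all_reals all_analysis.
Require Import Defs.

Set Implicit Arguments.
Unset Strict Implicit.
Unset Printing Implicit Defensive.

Import Order.TTheory GRing.Theory Num.Theory.
Import numFieldNormedType.Exports.

Local Open Scope classical_set_scope.
Local Open Scope ring_scope.
Local Open Scope sesquilinear_scope.

(** * Simultaneous diagonalisation of commuting matrices *)

(** What singles out these groups is that a commuting family can be diagonalised inside the group:
    in SO(3) the half-turns about orthogonal axes commute but lie in no common torus. For U(q) this
    is the spectral theorem, for SU(r) one row is rescaled to correct the determinant, and for Sp(k)
    each joint eigenvector is paired with its product by the quaternion j, whose eigenvalues are the
    conjugate ones. The same pairing limits the Weyl group of Sp(k): only permutations of the 2k
    diagonal positions that respect the pairs (i, k + i) are realised, so characters are first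
    matched up to conjugation and the swaps inside pairs are chosen afterwards. Multiplicities enter
    because the element diagonalising f_t need not vary continuously with t, whereas traces do. The
    values on A stay fixed while Z^n is contracted: a homomorphism from A to the reals is zero, so
    torsion has no additive lift to angles. *)

Section CommutingUnitary.
Variable C : numClosedFieldType.

(** The matrix of [M] on a basis of [U] has an eigenvector since [C] is algebraically closed;
    [row_base U] carries it back into [U]. *)
Lemma eigenvalue_stablemx n (U M : 'M[C]_n) : U != 0 -> stablemx U M ->
  exists a, (U :&: eigenspace M a)%MS != 0.
Proof.
move=> U0 UM; have r0 : (0 < \rank U)%N by rewrite lt0n mxrank_eq0.
have [a /eigenvalueP[w wM w0]] := eigenvalue_closed (restrictmx U M) r0.
exists a; apply/rowV0Pn; exists (w *m row_base U).
  rewrite sub_capmx (submx_trans (submxMl _ _)) ?eq_row_base //.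
  apply/eigenspaceP; rewrite scalemxAl -wM /conjmx -[RHS]mulmxA.
  by rewrite mulmxKpV ?mulmxA // stablemx_row_base.
by rewrite mulmx_free_eq0 ?row_base_free.
Qed.

(** [S] may be infinite, so the induction is on the rank of [U]: either every member is scalar on
    [U], or an eigenspace of a non-scalar one cuts out a smaller subspace, stable because the family
    commutes. *)
Lemma common_eigenvector_stable n (S : 'M[C]_n -> Prop) (U : 'M[C]_n) :
  (forall M N, S M -> S N -> M *m N = N *m M) ->
  U != 0 -> (forall M, S M -> stablemx U M) ->
  exists v : 'rV_n, [/\ v != 0, (v <= U)%MS &
    forall M, S M -> exists a, v *m M = a *: v].
Proof.
move=> SC; have [k] := ubnP (\rank U); elim: k U => // k IHk U Uk U0 US.
have [Uscal|] := pselect (forall M, S M -> exists a, (U <= eigenspace M a)%MS).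
  exists (nz_row U); split; rewrite ?nz_row_eq0 ?nz_row_sub //.
  move=> M /Uscal[a Ua]; exists a; apply/eigenspaceP.
  exact: submx_trans (nz_row_sub _) Ua.
move=> /existsNP[M /not_implyP[SM nU]].
have [a V0] := eigenvalue_stablemx U0 (US M SM).
have VU : (U :&: eigenspace M a <= U)%MS := capmxSl _ _.
have [||N SN|v [v0 vV vS]] := IHk (U :&: eigenspace M a)%MS.
- apply: leq_trans (Uk : (\rank U <= k)%N).
  apply: rank_ltmx; rewrite ltmxE VU; apply/negP => UV; apply: nU; exists a.
  exact: submx_trans UV (capmxSr _ _).
- exact: V0.
- rewrite sub_capmx (submx_trans (submxMr _ VU)) ?US //=.
  apply: submx_trans (submxMr _ (capmxSr _ _)) _.
  exact: comm_mx_stable_eigenspace (SC M N SM SN).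
- by exists v; split=> //; exact: submx_trans VU.
Qed.

Lemma unit_eigenvector_ortho n p (S : 'M[C]_n -> Prop) (W : 'M[C]_(p, n)) :
  (forall M N, S M -> S N -> M *m N = N *m M) ->
  (forall M, S M -> M \is unitarymx) ->
  (\rank W < n)%N -> (forall M, S M -> stablemx W M) ->
  exists v : 'rV[C]_n, [/\ v *m v^t* = 1%:M, v *m W^t* = 0 &
    forall M, S M -> exists a, v *m M = a *: v].
Proof.
move=> SC SU Wn WS; pose U := kermx (W^t*).
have U0 : U != 0.
  by rewrite -mxrank_eq0 /U mxrank_ker mxrank_map mxrank_tr -lt0n subn_gt0.
have [M SM|v [v0 /sub_kermxP vW vS]] := common_eigenvector_stable SC U0.
  apply/sub_kermxP; have MU := SU M SM.
  (* As [M] is invertible, [W *m M] has the rank of [W] and so equals it. Hence the adjoint [M^t*],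
     which is the inverse, preserves [W], and [M] preserves the orthogonal complement [U]. *)
  have WM : (W *m M^t* <= W)%MS.
    have /eqmxP/eqmx_sym/eqmxP/andP[WM _] : (W *m M == W)%MS.
      rewrite -(mxrank_leqif_eq (WS M SM)) mxrankMfree //.
      by rewrite row_free_unit unitarymx_unit.
    by rewrite (submx_trans (submxMr _ WM)) // mulmxtVK.
  case/submxP: WM => D WM.
  have -> : U *m M *m W^t* = U *m (W *m M^t*)^t*.
    by rewrite trmx_mul map_mxM trmxCK mulmxA.
  by rewrite WM trmx_mul map_mxM mulmxA mulmx_ker mul0mx.
have vv0 : 0 < dotmx v v by exact: dotmx_is_dotmx.
pose c := (sqrtC (dotmx v v))^-1.
have c_ge0 : 0 <= c by rewrite invr_ge0 sqrtC_ge0 ltW.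
exists (c *: v); split=> [||M /vS[a vM]].
- rewrite linearZ /= map_mxZ -scalemxAl -scalemxAr scalerA.
  rewrite [_ *m _]mx11_scalar -dotmxE -scalemx1 scalerA.
  rewrite [Num.Num_conj__canonical__GRing_RMorphism C c](geC0_conj c_ge0).
  rewrite -expr2 /c exprVn sqrtCK mulVf ?scale1r //.
  by rewrite gt_eqF.
- by rewrite -scalemxAl vW scaler0.
- by exists a; rewrite -scalemxAl vM !scalerA mulrC.
Qed.

(** The rows of [V] are joint eigenvectors. [V] may be rectangular because frames are grown one row
    at a time. *)
Definition codiagonalized n r (S : 'M[C]_n -> Prop) (V : 'M[C]_(r, n)) :=
  forall M, S M -> exists d, V *m M = diag_mx d *m V.

Lemma codiagonalized_col n r (S : 'M[C]_n -> Prop) (v : 'rV_n)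
    (V : 'M[C]_(r, n)) :
  (forall M, S M -> exists a, v *m M = a *: v) -> codiagonalized S V ->
  codiagonalized S (col_mx v V).
Proof.
move=> vS VS M SM; have [a vM] := vS M SM; have [d VM] := VS M SM.
exists (row_mx a%:M d); rewrite mul_col_mx vM VM diag_mx_row mul_block_col.
rewrite !mul0mx addr0 add0r; congr col_mx.
by apply/rowP => j; rewrite !mxE big_ord1 !mxE eqxx !mulr1n.
Qed.

Lemma codiagonalized_sub n r (S : 'M[C]_n -> Prop) (V : 'M[C]_(r, n)) M :
  codiagonalized S V -> S M -> stablemx V M.
Proof. by move=> VS /VS[d ->]; rewrite submxMl. Qed.

Lemma orthonormal_col m n r (v : 'M[C]_(m, n)) (V : 'M[C]_(r, n)) :
  v *m v^t* = 1%:M -> v *m V^t* = 0 -> V *m V^t* = 1%:M ->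
  col_mx v V *m (col_mx v V)^t* = 1%:M.
Proof.
move=> vv vV VV; rewrite tr_col_mx map_row_mx mul_col_row vv vV VV.
have -> : V *m v^t* = 0.
  by rewrite -[LHS]trmxCK trmx_mul map_mxM trmxCK vV trmx0 map_mx0.
by rewrite -scalar_mx_block.
Qed.

Lemma unitary_codiagonalization n (S : 'M[C]_n -> Prop) :
  (forall M N, S M -> S N -> M *m N = N *m M) ->
  (forall M, S M -> M \is unitarymx) ->
  exists2 P : 'M[C]_n, P \is unitarymx & codiagonalized S P.
Proof.
move=> SC SU.
suff: forall r, (r <= n)%N ->
    exists2 V : 'M[C]_(r, n), V \is unitarymx & codiagonalized S V.
  exact.
elim=> [_|r IHr rn].
  exists 0; first by apply/unitarymxP; rewrite [LHS]flatmx0 [RHS]flatmx0.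
  by move=> M _; exists 0; rewrite [LHS]flatmx0 [RHS]flatmx0.
have [V VU VS] := IHr (ltnW rn).
have [|M SM|v [vv vV vS]] := @unit_eigenvector_ortho _ _ S V SC SU.
- by rewrite mxrank_unitary.
- exact: codiagonalized_sub VS SM.
exists (col_mx v V : 'M[C]_(1 + r, n)); last exact: codiagonalized_col.
by apply/unitarymxP; exact: (orthonormal_col vv vV (unitarymxP VU)).
Qed.

(** * Symplectic diagonalisation through the quaternionic structure *)

Section Symplectic.
Variable k : nat.
Local Notation "M ^^j" := (map_mx Num.conj M) (at level 30).
Let J : 'M[C]_(k + k) := block_mx 0 1%:M (- 1%:M) 0.

Lemma sympl_tr : J^T = - J.
Proof.
by rewrite tr_block_mx !trmx0 linearN /= trmx1 opp_block_mx !oppr0 opprK.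
Qed.

Lemma sympl_conj : J^^j = J.
Proof. by rewrite map_block_mx !map_mx0 map_mxN map_mx1. Qed.

Lemma sympl_sqr : J *m J = - 1%:M.
Proof.
rewrite mulmx_block !mulmx0 !mul0mx !mulmx1 !mul1mx !add0r !addr0.
by rewrite scalar_mx_block opp_block_mx !oppr0.
Qed.

(* Multiplication by the quaternion j. *)
Definition sympl_flip r (V : 'M[C]_(r, k + k)) := V^^j *m J.

(** For unitary [M] the inverse of [M^T] is the conjugate of [M]. The right-hand side says that [M]
    commutes with [sympl_flip], that is, [M] is quaternion-linear. *)
Lemma sympl_commute (M : 'M[C]_(k + k)) : M \is unitarymx ->
  (M^T *m J *m M == J) = (J *m M == M^^j *m J).
Proof.
move=> MU; have MM : M^T *m M^^j = 1%:M.
  have := MU; rewrite -trmx_unitary => /unitarymxP <-.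
  by rewrite trmxK.
have MM' : M^^j *m M^T = 1%:M by exact: mulmx1C.
apply/eqP/eqP => h; first by rewrite -[X in _ = _ *m X]h !mulmxA MM' mul1mx.
by rewrite -mulmxA h mulmxA MM mul1mx.
Qed.

(** The flip is conjugate-linear and commutes with [M], so it sends eigenvectors to eigenvectors
    with conjugate eigenvalues. *)
Lemma sympl_flip_diag r (V : 'M[C]_(r, k + k)) M d :
  J *m M = M^^j *m J -> V *m M = diag_mx d *m V ->
  sympl_flip V *m M = diag_mx (d^^j) *m sympl_flip V.
Proof.
move=> JM VM; rewrite /sympl_flip -mulmxA JM !mulmxA -map_mxM VM map_mxM.
by rewrite map_diag_mx.
Qed.

(** The adjoint of [sympl_flip V] is [- (J *m V^T)], so the isotropy condition on [V] means that its
    rows are orthogonal to all the flips. *)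
Lemma sympl_flip_dot r (V : 'M[C]_(r, k + k)) :
  V *m V^t* = 1%:M -> V *m J *m V^T = 0 ->
  col_mx V (sympl_flip V) *m (col_mx V (sympl_flip V))^t* = 1%:M.
Proof.
move=> VV VJ; have Jt : J^t* = - J by rewrite sympl_tr map_mxN sympl_conj.
have Ft : (sympl_flip V)^t* = - (J *m V^T).
  rewrite trmx_mul map_mxM Jt mulNmx; congr (- (_ *m _)).
  by apply/matrixP => i j; rewrite !mxE; exact: conjCK.
have O1 : V *m (sympl_flip V)^t* = 0 by rewrite Ft mulmxN mulmxA VJ oppr0.
apply: orthonormal_col => //.
rewrite Ft /sympl_flip mulmxN mulmxA -[_ *m J *m J]mulmxA sympl_sqr.
rewrite mulmxN mulmx1 mulNmx opprK.
rewrite -[RHS](map_mx1 Num.conj) -VV map_mxM; congr (_ *m _).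
by apply/matrixP => i j; rewrite !mxE; apply/esym/conjCK.
Qed.

(** Flipping twice is multiplication by -1, so [J *m P] and the conjugate of [P] times [J] both have
    blocks [sympl_flip V] and [- V]. *)
Lemma sympl_flip_sympl (V : 'M[C]_(k, k + k)) :
  V *m V^t* = 1%:M -> V *m J *m V^T = 0 ->
  let P := col_mx V (sympl_flip V) in
  P \is unitarymx /\ P^T *m J *m P = J.
Proof.
move=> VV VJ P; have PU : P \is unitarymx by apply/unitarymxP/sympl_flip_dot.
split=> //; apply/eqP; rewrite sympl_commute //; apply/eqP.
have -> : J *m P = col_mx (sympl_flip V) (- V).
  by rewrite /J mul_block_col !mul0mx add0r addr0 mulNmx !mul1mx.
rewrite /P map_col_mx mul_col_mx; congr col_mx.
rewrite /sympl_flip map_mxM sympl_conj -mulmxA sympl_sqr mulmxN mulmx1.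
by congr (- _); apply/matrixP => i j; rewrite !mxE; apply/esym/conjCK.
Qed.

Lemma sympl_codiagonalization (S : 'M[C]_(k + k) -> Prop) :
  (forall M N, S M -> S N -> M *m N = N *m M) ->
  (forall M, S M -> M \is unitarymx /\ M^T *m J *m M = J) ->
  exists P : 'M[C]_(k + k),
    [/\ P \is unitarymx, P^T *m J *m P = J & codiagonalized S P].
Proof.
move=> SC SJ.
have SU M : S M -> M \is unitarymx by case/SJ.
have JM M : S M -> J *m M = M^^j *m J.
  by move=> /SJ[MU /eqP]; rewrite sympl_commute // => /eqP.
(* Only [k] rows have to be found: their flips are joint eigenvectors too and complete the basis.
   Each new row is therefore taken orthogonal to the earlier rows and to their flips. *)
suff: forall r, (r <= k)%N -> exists V : 'M[C]_(r, k + k),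
    [/\ V *m V^t* = 1%:M, V *m J *m V^T = 0 & codiagonalized S V].
  move=> /(_ k (leqnn k))[V [VV VJ VS]].
  have [PU PJ] := sympl_flip_sympl VV VJ.
  exists (col_mx V (sympl_flip V)); split=> // M SM; have [d VM] := VS M SM.
  exists (row_mx d (d^^j)).
  rewrite mul_col_mx VM (sympl_flip_diag (JM M SM) VM).
  by rewrite diag_mx_row mul_block_col !mul0mx addr0 add0r.
elim=> [_|r IHr rk].
  exists 0; split; rewrite ?[LHS]flatmx0 ?[RHS]flatmx0 //.
  by move=> M _; exists 0; rewrite [LHS]flatmx0 [RHS]flatmx0.
have [V [VV VJ VS]] := IHr (ltnW rk).
have [|M SM|v [vv vW vS]] := @unit_eigenvector_ortho _ _ S
   (col_mx V (sympl_flip V)) SC SU.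
- by rewrite (leq_ltn_trans (rank_leq_row _)) // -addSn leq_add // ltnW.
- have [d VM] := VS M SM.
  rewrite mul_col_mx col_mx_sub VM (sympl_flip_diag (JM M SM) VM).
  rewrite -!addsmxE; apply/andP; split.
    exact: submx_trans (submxMl _ _) (addsmxSl _ _).
  exact: submx_trans (submxMl _ _) (addsmxSr _ _).
move: vW; rewrite tr_col_mx map_row_mx mul_mx_row -[0]hsubmxK => /eq_row_mx[].
rewrite !linear0 => vV vF.
have vJV : v *m J *m V^T = 0.
  move: vF; rewrite /sympl_flip trmx_mul sympl_tr mulNmx map_mxN map_mxM.
  rewrite sympl_conj mulmxN => /eqP; rewrite oppr_eq0 mulmxA => /eqP <-.
  by congr (_ *m _); apply/matrixP => i j; rewrite !mxE; apply/esym/conjCK.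
(* [J] is antisymmetric, so this 1 x 1 matrix equals its own opposite: a vector is always orthogonal
   to its flip. *)
have vJv : v *m J *m v^T = 0.
  have : (v *m J *m v^T)^T = - (v *m J *m v^T).
    by rewrite !trmx_mul trmxK sympl_tr mulNmx mulmxN mulmxA.
  rewrite [v *m J *m v^T]mx11_scalar tr_scalar_mx => /matrixP/(_ 0 0).
  rewrite !mxE eqxx !mulr1n => /eqP; rewrite -addr_eq0 -mulr2n mulrn_eq0 /=.
  by move=> /eqP ->; rewrite raddf0.
exists (col_mx v V : 'M[C]_(1 + r, k + k)); split;
  last exact: codiagonalized_col.
- exact: (orthonormal_col vv vV VV).
- have VJv : V *m J *m v^T = 0.
    apply: trmx_inj; rewrite !trmx_mul trmxK sympl_tr mulNmx mulmxN mulmxA.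
    by rewrite vJV oppr0 trmx0.
  have : col_mx v V *m J *m (col_mx v V)^T = 0.
    rewrite tr_col_mx mul_col_mx mul_col_row vJv vJV VJ VJv.
    by rewrite /block_mx !row_mx0 col_mx0.
  exact.
Qed.

End Symplectic.
End CommutingUnitary.

(** * Multiplicities of characters and monomial matrices *)

Section UnitCharacters.
Variables (C : numClosedFieldType) (A : finZmodType).

(** Characters are finite functions so that they have decidable equality and can be counted in a
    sequence. *)
Definition unit_character (x : {ffun A -> C}) :=
  (forall a b, x (a + b) = x a * x b) /\ (forall a, x a * (x a)^* = 1).

(** If [x] and [y] differ at [b], translating the sum by [b] multiplies it by a factor other than 1,
    so it vanishes. *)
Lemma unit_character_orthogonal x y : unit_character x -> unit_character y ->
  \sum_a (x a)^* * y a = #|A|%:R * (x == y)%:R.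
Proof.
move=> xC yC; have [->|xy] := eqVneq x y.
  rewrite mulr1 (eq_bigr (fun=> 1)) ?sumr_const // => a _.
  by rewrite mulrC yC.2.
rewrite mulr0; set s := \sum_a _.
have [b xyb] : exists b, (x b)^* * y b != 1.
  apply/existsP; apply: contraNT xy; rewrite negb_exists => /forallP h.
  apply/eqP/ffunP => a; have /negPn/eqP e := h a.
  by rewrite -[LHS]mulr1 -e mulrA xC.2 mul1r.
have : s = (x b)^* * y b * s.
  rewrite mulr_sumr /s (reindex_inj (addrI b)) /=; apply: eq_bigr => a _.
  by rewrite xC.1 yC.1 rmorphM /= mulrACA.
move/eqP; rewrite -subr_eq0 -[X in X - _]mul1r -mulrBl mulf_eq0 subr_eq0.
by rewrite eq_sym (negPf xyb) => /eqP.
Qed.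

(** Kept complex-valued so that continuity in [f] can be stated; integrality is
    [multiplicity_nat]. *)
Definition multiplicity n (x : {ffun A -> C}) (f : A -> 'M[C]_n) : C :=
  #|A|%:R^-1 * \sum_a (x a)^* * \tr (f a).

Definition diag_characters n (f : A -> 'M[C]_n) : n.-tuple {ffun A -> C} :=
  [tuple [ffun a => f a i i] | i < n].

Lemma multiplicity_diag n (x : {ffun A -> C}) (f : A -> 'M[C]_n) :
  unit_character x -> (forall i, unit_character [ffun a => f a i i]) ->
  multiplicity x f = (count_mem x (diag_characters f))%:R.
Proof.
move=> xC fC; rewrite /multiplicity.
under eq_bigr do rewrite mulr_sumr.
rewrite exchange_big /=.
pose term i : C := #|A|%:R * (x == [ffun a => f a i i])%:R.
rewrite (eq_bigr term); last first.
  move=> i _; rewrite /term -unit_character_orthogonal //.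
  apply: eq_bigr => a _.
  by rewrite ffunE.
have A0 : #|A|%:R != 0 :> C.
  by rewrite pnatr_eq0 -lt0n; apply/card_gt0P; exists 0.
rewrite /term -mulr_sumr mulrA mulVf // mul1r -natr_sum; congr _%:R.
rewrite -sum1_count /= big_map big_enum_cond [RHS]big_mkcond /=.
by apply: eq_bigr => i _; rewrite eq_sym; case: eqP.
Qed.

Lemma diag_characters_perm_eq n (f g : A -> 'M[C]_n) :
  (forall i, unit_character [ffun a => f a i i]) ->
  (forall i, unit_character [ffun a => g a i i]) ->
  (forall x, unit_character x -> multiplicity x f = multiplicity x g) ->
  perm_eq (diag_characters f) (diag_characters g).
Proof.
move=> fC gC fg; rewrite /perm_eq; apply/allP => x; rewrite mem_cat => xfg.
have xC : unit_character x.
  by case/orP: xfg => /mapP[i _ ->].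
have := fg x xC; rewrite !multiplicity_diag // => /eqP.
by rewrite eqr_nat.
Qed.

Lemma multiplicity_conj n (P : 'M[C]_n) x (f : A -> 'M[C]_n) :
  P \is unitarymx ->
  multiplicity x (fun a => P *m f a *m P^t*) = multiplicity x f.
Proof.
move=> PU; congr (_ * _); apply: eq_bigr => a _; congr (_ * _).
by rewrite mxtrace_mulC mulmxA (mulmx1C (unitarymxP PU)) mul1mx.
Qed.

End UnitCharacters.

(** * Monomial unitary matrices and the normaliser of the diagonal torus *)

Section Monomial.
Variable C : numClosedFieldType.

(** Row [i] of [P] is supported in column [s i], so moving [D] to the left of [P] replaces its
    [i]-th entry by the one at [s i]. *)
Lemma monomial_diag n (P D : 'M[C]_n) (s : 'S_n) : P \is unitarymx ->
  (forall i j, j != s i -> P i j = 0) -> is_diag_mx D ->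
  P *m D *m P^t* = diag_mx (\row_i D (s i) (s i)).
Proof.
move=> PU Ps /is_diag_mxP DD.
suff -> : P *m D = diag_mx (\row_i D (s i) (s i)) *m P by rewrite mulmxtVK.
apply/matrixP => i j; rewrite mul_diag_mx !mxE (bigD1 j) //= big1 => [|l lj].
  rewrite addr0; have [->|js] := eqVneq j (s i); first exact: mulrC.
  by rewrite Ps // mulr0 mul0r.
by rewrite DD // mulr0.
Qed.

Lemma unitary_diag_mx n (d : 'rV[C]_n) :
  (forall i, d 0 i * (d 0 i)^* = 1) -> diag_mx d \is unitarymx.
Proof.
move=> dU; apply/unitarymxP; rewrite tr_diag_mx map_diag_mx mulmx_diag.
rewrite -[RHS]diag_const_mx; congr diag_mx; apply/rowP => i; rewrite !mxE.
exact: dU.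
Qed.

(** One row is multiplied by the conjugate of [\det P], which has modulus 1. Rescaling rows
    preserves both joint eigenvectors and monomial shape, so this serves SU in the diagonalisation
    and in the Weyl group. *)
Lemma unitary_scale_det1 n (P : 'M[C]_n) : P \is unitarymx ->
  exists d : 'rV_n, diag_mx d *m P \is unitarymx /\ \det (diag_mx d *m P) = 1.
Proof.
move=> PU; have dP : \det P * (\det P)^* = 1.
  by rewrite -(det_tr P) -[X in _ * X]det_map_mx det_tr -det_mulmx
    (unitarymxP PU) det1.
case: n P PU dP => [|n] P PU dP.
  by exists 0; rewrite det_mx00; split=> //; apply/unitarymxP/matrixP; case.
pose d : 'rV[C]_n.+1 := \row_i if i == 0 then (\det P)^* else 1.
exists d; split.
  rewrite mul_unitarymx // unitary_diag_mx // => i; rewrite mxE.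
  by case: eqP => _; rewrite ?conjC1 ?mulr1 // conjCK mulrC.
rewrite det_mulmx det_diag (bigD1 0) //= big1 ?mxE ?eqxx ?mulr1 1?mulrC //.
by move=> i /negPf i0; rewrite mxE i0.
Qed.
End Monomial.

Lemma normaliserP (G : topologicalGroupType) (T : set G) (g : G) :
  (forall t, T t -> T (g * t * g^-1)%g) ->
  (forall t, T t -> T (g^-1 * t * g)%g) -> normaliser T g.
Proof.
move=> gT gVT; apply/seteqP; split=> [_ [t Tt <-]|t Tt]; first exact: gT.
by exists (g^-1 * t * g)%g; [exact: gVT|rewrite !mulgA mulgV mul1g mulgK].
Qed.

Section FactorTorus.
Variables (C : numClosedFieldType) (c : classical_type).
Implicit Types M N g : factor_grp C c.

Definition diag_torus : set (factor_grp C c) :=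
  [set M | is_diag_mx (factor_mx M)].

Lemma normaliser_monomial g (s : 'S_(degree c)) :
  (forall i j, j != s i -> g i j = 0) -> normaliser diag_torus g.
Proof.
move=> gs; have gU := factor_unitary g.
apply: normaliserP => t td; rewrite /diag_torus /=.
  rewrite (monomial_diag gU gs) //; exact: diag_mx_is_diag.
(* Writing [g] as the adjoint of [g^t*] puts the product in the form of [monomial_diag] for the
   monomial matrix [g^t*], whose permutation is the inverse of [s]. *)
rewrite -{2}[factor_mx g]trmxCK.
rewrite (@monomial_diag _ _ _ _ (s^-1)%g) ?trmxC_unitary ?diag_mx_is_diag //.
move=> i j ij; rewrite !mxE gs ?conjC0 //; apply: contraNneq ij => ->.
by rewrite permK.
Qed.

End FactorTorus.

Lemma codiagonalized_diag (C : numClosedFieldType) n (S : 'M[C]_n -> Prop)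
    (P M : 'M[C]_n) :
  P \is unitarymx -> codiagonalized S P -> S M -> is_diag_mx (P *m M *m P^t*).
Proof.
by move=> PU PS /PS[d ->]; rewrite mulmxtVK // diag_mx_is_diag.
Qed.

Lemma codiagonalized_scale (C : numClosedFieldType) n (S : 'M[C]_n -> Prop)
    (P : 'M[C]_n) (e : 'rV_n) :
  codiagonalized S P -> codiagonalized S (diag_mx e *m P).
Proof.
move=> PS M /PS[d PM]; exists d.
by rewrite -mulmxA PM !mulmxA !mulmx_diag; congr (diag_mx _ *m _);
  apply/rowP => i; rewrite !mxE mulrC.
Qed.

Lemma factor_codiagonalization (C : numClosedFieldType) c
    (S : set (factor_grp C c)) :
  (forall M N, S M -> S N -> (M * N = N * M)%g) ->
  exists g, forall M, S M -> diag_torus (g * M * g^-1)%g.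
Proof.
move=> SC; pose S' := [set factor_mx M | M in S].
have S'C M N : S' M -> S' N -> M *m N = N *m M.
  move=> [M' SM <-] [N' SN <-].
  exact: (congr1 (@factor_mx C c) (SC _ _ SM SN)).
have S'U M : S' M -> M \is unitarymx.
  by move=> [M' _ <-]; exact: factor_unitary.
suff [P PG PS] : exists2 P, factor_pred P & codiagonalized S' P.
  exists (FactorGrp PG) => M SM; rewrite /diag_torus /=.
  apply: (codiagonalized_diag _ PS); last by exists M.
  exact: (factor_unitary (FactorGrp PG)).
case: c S SC @S' S'C S'U => k S _ S' S'C S'U /=.
- have [P PU PS] := unitary_codiagonalization S'C S'U.
  have [d [dU dP]] := unitary_scale_det1 PU.
  exists (diag_mx d *m P); first by rewrite dU dP eqxx.
  exact: codiagonalized_scale.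
- by have [P PU PS] := unitary_codiagonalization S'C S'U; exists P.
- have [M SM|P [PU PJ PS]] := sympl_codiagonalization S'C.
    split; first exact: S'U.
    by case: SM => -[M' M'G] _ <- /=; case/andP: M'G => _ /eqP.
  by exists P; rewrite // PU PJ eqxx.
Qed.

(** * Diagonal homomorphisms conjugated by monomial elements *)

Section DiagHom.
Variables (C : numClosedFieldType) (A : finZmodType).

Lemma diag_hom_character c (f : hom A (factor_grp C c)) i :
  hom_into (@diag_torus C c) f -> unit_character [ffun a => f a i i].
Proof.
move=> fD.
have dm (M N : 'M[C]_(degree c)) : is_diag_mx M -> (M *m N) i i = M i i * N i i.
  move=> /is_diag_mxP MD; rewrite mxE (bigD1 i) //= big1 ?addr0 // => j ji.
  by rewrite MD ?mul0r // eq_sym.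
split=> [a b|a]; rewrite !ffunE.
  by rewrite homD; exact/dm/fD.
have /unitarymxP/matrixP/(_ i i) := factor_unitary (f a).
by rewrite dm ?mxE ?eqxx //; exact: fD.
Qed.

Let dchars c (f : hom A (factor_grp C c)) :=
  diag_characters (fun a => factor_mx (f a)).

Lemma perm_eq_monomial n (f g : A -> 'M[C]_n) :
  perm_eq (diag_characters g) (diag_characters f) ->
  exists s : 'S_n, forall a i, g a i i = f a (s i) (s i).
Proof.
case/tuple_permP => s gf; exists s => a i.
have : tnth (diag_characters g) i = tnth (diag_characters f) (s i).
  by rewrite (val_inj gf) tnth_mktuple.
by rewrite !tnth_mktuple => /ffunP/(_ a); rewrite !ffunE.
Qed.

(** Reduces the Weyl group statement for each family to realising a permutation of the diagonal by a
    monomial element of the group. *)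
Lemma monomial_conj_hom c (f g : hom A (factor_grp C c)) (w : factor_grp C c)
    (s : 'S_(degree c)) :
  hom_into (@diag_torus C c) f -> hom_into (@diag_torus C c) g ->
  (forall i j, j != s i -> w i j = 0) ->
  (forall a i, g a i i = f a (s i) (s i)) ->
  normaliser (@diag_torus C c) w /\ conj_hom w f = g.
Proof.
move=> fD gD ws gf; split; first exact: normaliser_monomial ws.
apply: hom_eq => a; apply: val_inj; rewrite /=.
rewrite (monomial_diag (factor_unitary w) ws) ?fD //; apply/matrixP => i j.
have [<-|ij] := eqVneq i j; first by rewrite !mxE eqxx gf.
by rewrite mxE (negPf ij) (is_diag_mxP (gD a)).
Qed.

Lemma perm_mx_unitary n (s : 'S_n) : (perm_mx s : 'M[C]_n) \is unitarymx.
Proof.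
apply/unitarymxP; rewrite tr_perm_mx map_perm_mx -perm_mxM mulgV.
exact: perm_mx1.
Qed.

Lemma perm_mx_eq0 n (s : 'S_n) i j : j != s i -> (perm_mx s : 'M[C]_n) i j = 0.
Proof. by move=> ij; rewrite !mxE eq_sym (negPf ij). Qed.

Lemma weyl_conj_U n (f g : hom A (factor_grp C (FactorU n))) :
  hom_into (@diag_torus C _) f -> hom_into (@diag_torus C _) g ->
  perm_eq (dchars g) (dchars f) ->
  exists2 w, normaliser (@diag_torus C _) w & conj_hom w f = g.
Proof.
move=> fD gD /perm_eq_monomial[s gf].
pose w := @FactorGrp C (FactorU n) _ (perm_mx_unitary s).
have [|] := @monomial_conj_hom _ f g w s fD gD _ gf; last by exists w.
exact: perm_mx_eq0.
Qed.

Lemma weyl_conj_SU n (f g : hom A (factor_grp C (FactorSU n))) :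
  hom_into (@diag_torus C _) f -> hom_into (@diag_torus C _) g ->
  perm_eq (dchars g) (dchars f) ->
  exists2 w, normaliser (@diag_torus C _) w & conj_hom w f = g.
Proof.
move=> fD gD /perm_eq_monomial[s gf].
have [d [dU dP]] := unitary_scale_det1 (perm_mx_unitary s).
have dG : factor_pred (diag_mx d *m perm_mx s : 'M[C]_(degree (FactorSU n))).
  by rewrite /= dU dP eqxx.
have [i j ij|] := @monomial_conj_hom _ f g (FactorGrp dG) s fD gD _ gf.
  by rewrite /= mul_diag_mx mxE perm_mx_eq0 // mulr0.
by exists (FactorGrp dG).
Qed.

End DiagHom.

(** * The Weyl group of Sp(k) acting on conjugate pairs of characters *)

Section SymplecticWeyl.
Variables (C : numClosedFieldType) (A : finZmodType) (k : nat).
Local Notation Sp := (factor_grp C (FactorSp k)).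
Local Notation D := (@diag_torus C (FactorSp k)).

(** This is the quaternion-linearity relation of [sympl_commute], read at the entry in row [i] and
    column [k + i]. *)
Lemma sympl_diag (M : Sp) i : D M ->
  M (rshift k i) (rshift k i) = (M (lshift k i) (lshift k i))^*.
Proof.
move=> /is_diag_mxP MD; have MU := factor_unitary M.
have MJ : sympl_form C k *m factor_mx M =
    map_mx Num.conj (factor_mx M) *m sympl_form C k.
  by apply/eqP; rewrite -sympl_commute //; case: (M) => M' /= /andP[].
have /matrixP/(_ (lshift k i) (rshift k i)) := MJ.
rewrite !mxE !big_split_ord /=.
under eq_bigr do rewrite block_mxEul mxE mul0r.
under [X in _ + X = _]eq_bigr do rewrite block_mxEur mxE.
under [X in _ = X + _]eq_bigr do rewrite block_mxEur !mxE.
under [X in _ = _ + X]eq_bigr do rewrite block_mxEdr !mxE mulr0.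
rewrite !big1_eq add0r addr0 (bigD1 i) //= eqxx mul1r big1 ?addr0.
  rewrite (bigD1 i) //= eqxx mulr1 big1 ?addr0 // => j ji.
  by rewrite (negPf ji) mulr0.
by move=> j ji; rewrite eq_sym (negPf ji) mul0r.
Qed.

(* A representative of the pair [{x, conj x}]. *)
Definition conj_repr (x : {ffun A -> C}) : {ffun A -> C} :=
  choose (pred2 x [ffun a => (x a)^*]) x.

Lemma conj_ffunK (x : {ffun A -> C}) :
  [ffun a => ([ffun b => (x b)^*] a)^*] = x.
Proof. by apply/ffunP => a; rewrite !ffunE conjCK. Qed.

Lemma conj_repr_conj (x : {ffun A -> C}) :
  conj_repr ([ffun a => (x a)^*] : {ffun A -> C}) = conj_repr x.
Proof.
rewrite /conj_repr conj_ffunK.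
rewrite -(@choose_id _ _ x [ffun a => (x a)^*]) /= ?eqxx ?orbT //.
by apply: eq_choose => y /=; rewrite orbC.
Qed.

Lemma conj_repr_eq (x y : {ffun A -> C}) :
  conj_repr x = conj_repr y -> x = y \/ x = [ffun a => (y a)^*].
Proof.
move=> xy; have /= : pred2 x [ffun a => (x a)^*] (conj_repr x).
  by apply: chooseP; rewrite /= eqxx.
have /= : pred2 y [ffun a => (y a)^*] (conj_repr y).
  by apply: chooseP; rewrite /= eqxx.
rewrite -xy => /orP[]/eqP-> /orP[]/eqP e.
- by left.
- by right; rewrite e conj_ffunK.
- by right; rewrite -e.
- by left; rewrite -[x]conj_ffunK -e conj_ffunK.
Qed.

(** The given permutation of the 2k characters may break the pairs. Replacing characters by
    representatives of their pairs gives a permutation of the [k] pairs instead. *)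
Lemma perm_eq_conj_repr (f g : hom A Sp) : hom_into D f -> hom_into D g ->
  perm_eq (diag_characters (fun a => factor_mx (g a)))
          (diag_characters (fun a => factor_mx (f a))) ->
  exists s : 'S_k, forall i,
    let x := [ffun a => f a (lshift k (s i)) (lshift k (s i))] in
    let y := [ffun a => g a (lshift k i) (lshift k i)] in
    y = x \/ y = [ffun a => (x a)^*].
Proof.
move=> fD gD.
pose t (h : hom A Sp) : k.-tuple {ffun A -> C} :=
  [tuple conj_repr [ffun a => h a (lshift k i) (lshift k i)] | i < k].
(* Positions [i] and [k + i] carry conjugate characters, hence the same representative. Every count
   is thus twice the count over the first [k] positions and can be halved. *)
have reprE h p : hom_into D h ->
    count p (map conj_repr (diag_characters (fun a => factor_mx (h a)))) =
    (count p (t h)).*2.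
  move=> hD; rewrite -!sum1_count /= -!map_comp !big_map.
  rewrite -!enumT !big_enum_cond /=.
  rewrite big_split_ord /= -addnn; congr addn; apply: eq_bigl => i //=; congr p.
  rewrite -[RHS]conj_repr_conj; congr conj_repr; apply/ffunP => a.
  by rewrite !ffunE (sympl_diag _ (hD a)).
move=> /(perm_map conj_repr) /permP gf.
have /tuple_permP[s ts] : perm_eq (t g) (t f).
  by apply/permP => p; apply: double_inj; rewrite -!reprE //; exact: gf.
exists s => i x y; apply: conj_repr_eq.
have : tnth (t g) i = tnth (t f) (s i) by rewrite (val_inj ts) tnth_mktuple.
by rewrite !tnth_mktuple.
Qed.

Lemma sympl_formE (i j : 'I_k) :
  (sympl_form C k (lshift k i) (lshift k j) = 0) *
  (sympl_form C k (lshift k i) (rshift k j) = (i == j)%:R) *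
  (sympl_form C k (rshift k i) (lshift k j) = - (i == j)%:R) *
  (sympl_form C k (rshift k i) (rshift k j) = 0).
Proof.
by rewrite /sympl_form block_mxEul block_mxEur block_mxEdl block_mxEdr !mxE.
Qed.

Lemma weyl_conj_Sp (f g : hom A Sp) : hom_into D f -> hom_into D g ->
  perm_eq (diag_characters (fun a => factor_mx (g a)))
          (diag_characters (fun a => factor_mx (f a))) ->
  exists2 w, normaliser D w & conj_hom w f = g.
Proof.
move=> fD gD /(perm_eq_conj_repr fD gD)[s /= gf].
(* [b i] records whether the [i]-th character of [g] is matched directly or through its conjugate,
   [t i] is the position where it occurs in [f], and [t' i] is the partner position. *)
pose b i := [ffun a => g a (lshift k i) (lshift k i)] ==
            [ffun a => f a (lshift k (s i)) (lshift k (s i))].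
pose t i : 'I_(k + k) := if b i then lshift k (s i) else rshift k (s i).
pose t' i : 'I_(k + k) := if b i then rshift k (s i) else lshift k (s i).
have tI i j : t i = t j -> i = j.
  rewrite /t; case: (b i); case: (b j) => /eqP; rewrite eq_shift // => /eqP.
    exact: perm_inj.
  exact: perm_inj.
pose st (i : 'I_(k + k)) : 'I_(k + k) :=
  match fintype.split i with inl j => t j | inr j => t' j end.
have stI : injective (st : 'I_(k + k) -> 'I_(k + k)).
  move=> i j; rewrite /st.
  case: (split_ordP i) => i' ->; case: (split_ordP j) => j' ->;
    rewrite /t /t'; case bi: (b i'); case bj: (b j') => /eqP;
    rewrite eq_shift // => /eqP /perm_inj ij; rewrite ?ij //;
    by move: bi; rewrite ij bj.
pose V : 'M[C]_(k, k + k) := \matrix_(i, j) (j == t i)%:R.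
have VJE i j : (V *m sympl_form C k) i j = sympl_form C k (t i) j.
  rewrite mxE (bigD1 (t i)) //= mxE eqxx mul1r big1 ?addr0 // => l lt.
  by rewrite mxE (negPf lt) mul0r.
have VV : V *m V^t* = 1%:M.
  apply/matrixP => i j; rewrite mxE (bigD1 (t i)) //= big1 ?addr0.
    rewrite !mxE eqxx mul1r rmorph_nat; congr (_%:R); congr nat_of_bool.
    by apply/eqP/eqP => [/tI|->].
  by move=> l lt; rewrite mxE (negPf lt) mul0r.
(* Isotropy holds because [t i] and [t j] are never partners: that would force [s i = s j], hence
   [i = j], but [t i] is not its own partner. *)
have VJ : V *m sympl_form C k *m V^T = 0.
  apply/matrixP => i j; rewrite mxE (bigD1 (t j)) //= big1 ?addr0.
    rewrite VJE [X in _ * X]mxE [X in _ * X]mxE eqxx mulr1 /t.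
    case bi: (b i); case bj: (b j); rewrite sympl_formE ?mxE //.
      have [/perm_inj ij|//] := eqVneq (s i) (s j).
      by move: bi; rewrite ij bj.
    have [/perm_inj ij|_] := eqVneq (s i) (s j); last by rewrite oppr0.
    by move: bi; rewrite ij bj.
  by move=> l lt; rewrite !mxE (negPf lt) mulr0.
have [PU PJ] := sympl_flip_sympl VV VJ.
have PG : factor_pred (col_mx V (sympl_flip V) : 'M[C]_(degree (FactorSp k))).
  by rewrite /= PU; apply/eqP.
have [||] := @monomial_conj_hom _ _ _ f g (FactorGrp PG) (perm stI) fD gD;
  last by move=> wN wf; exists (FactorGrp PG).
  move=> i j; rewrite permE /st /=; case: (split_ordP i) => i' -> jt.
    by rewrite col_mxEu mxE (negPf jt).
  (* [V] is real, so row [i'] of the flip is row [t i'] of the symplectic form, whose only nonzero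
     entry is a sign in column [t' i']. *)
  rewrite col_mxEd /sympl_flip.
  have -> : map_mx Num.conj V = V.
    by apply/matrixP => p q; rewrite !mxE rmorph_nat.
  rewrite VJE; move: jt; rewrite /t /t'.
  case: (b i'); case: (split_ordP j) => j' ->;
    rewrite eq_shift sympl_formE // eq_sym => /negPf ->; by rewrite ?oppr0.
have bE i a : g a (lshift k i) (lshift k i) = f a (t i) (t i).
  rewrite /t; case: ifPn => [/eqP/ffunP/(_ a)|]; first by rewrite !ffunE.
  rewrite /b; case: (gf i) => [->|/ffunP/(_ a) + _]; first by rewrite eqxx.
  by rewrite !ffunE (sympl_diag _ (fD a)).
move=> a i; rewrite permE /st; case: (split_ordP i) => i' -> //.
rewrite (sympl_diag _ (gD a)) bE /t /t'; case: (b i').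
  by rewrite (sympl_diag _ (fD a)).
by rewrite (sympl_diag _ (fD a)) conjCK.
Qed.

End SymplecticWeyl.

(** * The diagonal torus *)

Section DiagTorus.
Variable C : numClosedFieldType.
Local Notation circle := (factor_grp C (FactorU 1)).

Definition circle_coord (z : circle) : C := factor_mx z 0 0.

(* The identity when [x] is not of modulus 1. *)
Definition circle_of (x : C) : circle :=
  insubd (1%g : circle) (x%:M : 'M[C]_(degree (FactorU 1))).

Lemma circle_coord_unit z : circle_coord z * (circle_coord z)^* = 1.
Proof.
have /unitarymxP/matrixP/(_ 0 0) := factor_unitary z.
by rewrite !mxE big_ord1 !mxE eqxx.
Qed.

Lemma circle_ofK (x : C) : x * x^* = 1 -> circle_coord (circle_of x) = x.
Proof.
move=> xx; rewrite /circle_coord /circle_of.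
have /= := @val_insubd _ _ (factor_grp C (FactorU 1)) 1%g x%:M => ->.
suff -> : (x%:M : 'M[C]_1) \is unitarymx by rewrite mxE eqxx.
apply/unitarymxP/matrixP => i j.
by rewrite !ord1 !mxE big_ord1 !mxE !eqxx /= !mulr1n.
Qed.

Lemma circle_coordK z : circle_of (circle_coord z) = z.
Proof.
apply: val_inj; apply/matrixP => i j; rewrite !ord1.
exact: circle_ofK (circle_coord_unit z).
Qed.

Lemma circle_coord_continuous : continuous circle_coord.
Proof. exact: factor_entry_continuous. Qed.

Lemma circle_coordM y z :
  circle_coord (y * z)%g = circle_coord y * circle_coord z.
Proof. by rewrite /circle_coord /= !mxE big_ord1. Qed.

Lemma diag_entryM c (M N : factor_grp C c) i :
  diag_torus M -> (M * N)%g i i = M i i * N i i.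
Proof.
move=> /is_diag_mxP MD; rewrite /= mxE (bigD1 i) //= big1 ?addr0 // => j ji.
by rewrite MD ?mul0r // eq_sym.
Qed.

Lemma diag_entry_unit c (M : factor_grp C c) i :
  diag_torus M -> M i i * (M i i)^* = 1.
Proof.
move=> MD; have /unitarymxP/matrixP/(_ i i) := factor_unitary M.
by rewrite (diag_entryM (M^-1)%g i MD) /= !mxE eqxx.
Qed.

(** [iota] selects the free diagonal entries and [ext] recovers the whole diagonal from them, so
    each family only supplies its own relation among diagonal entries. *)
Lemma coordinates_torus c k (iota : 'I_k -> 'I_(degree c))
    (ext : ('I_k -> C) -> 'I_(degree c) -> C) :
  (forall u v i, ext (fun j => u j * v j) i = ext u i * ext v i) ->
  (forall u, (forall j, u j * (u j)^* = 1) ->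
    factor_pred (diag_mx (\row_i ext u i))) ->
  (forall u j, ext u (iota j) = u j) ->
  (forall (M : factor_grp C c) i, diag_torus M ->
    M i i = ext (fun j => M (iota j) (iota j)) i) ->
  (forall i, continuous (fun z : circle_power C k =>
    ext (fun j => circle_coord (z j)) i)) ->
  is_torus C (@diag_torus C c).
Proof.
move=> extM extG ext_iota extE ext_cont.
pose phi (z : circle_power C k) : factor_grp C c :=
  FactorGrp (extG _ (fun j => circle_coord_unit (z j))).
pose psi (M : factor_grp C c) : circle_power C k :=
  fun j => circle_of (M (iota j) (iota j)).
have phiD z : diag_torus (phi z) by exact: diag_mx_is_diag.
have phiE z i : phi z i i = ext (fun j => circle_coord (z j)) i.
  by rewrite !mxE eqxx.
have diagP (M N : factor_grp C c) : diag_torus M -> diag_torus N ->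
    (forall i, M i i = N i i) -> M = N.
  move=> /is_diag_mxP MD /is_diag_mxP ND MN; apply/val_inj/matrixP => i j.
  by have [->|ij] := eqVneq i j; rewrite ?MN // MD ?ND.
have psiK z : psi (phi z) = z.
  apply/functional_extensionality_dep => j.
  by rewrite /psi phiE ext_iota circle_coordK.
exists k, phi, psi; split=> //.
- move=> y z; apply: diagP => // [|i].
    by rewrite /diag_torus /= mulmx_diag diag_mx_is_diag.
  rewrite diag_entryM // !phiE -extM; congr ext; apply/funext => j.
  exact: circle_coordM.
- apply/seteqP; split=> [_ [z _ <-]|M MD]; first exact: phiD.
  exists (psi M) => //; apply: diagP => // i; rewrite phiE extE //.
  congr ext; apply/funext => j; apply: circle_ofK; exact: diag_entry_unit.
- apply: continuous_comp_initial => z.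
  apply: (cvg_mx (nbhs_filter (z : circle_power C k))) => i j /=.
  have [<-|ij] := eqVneq i j.
    under eq_cvg do rewrite !mxE eqxx mulr1n.
    rewrite !mxE eqxx mulr1n; exact: ext_cont.
  under eq_cvg do rewrite !mxE (negPf ij) mulr0n.
  by rewrite !mxE (negPf ij) mulr0n; exact: cvg_cst.
- apply: prod_group_continuous => j; apply: continuous_comp_initial.
  (* Off the torus an entry may fail to have modulus 1 and [circle_of] then takes its default value.
     On the torus it agrees with the scalar matrix of the entry, which is continuous everywhere. *)
  apply: (@subspace_eq_continuous _ _ _ (fun M : factor_grp C c =>
    ((M (iota j) (iota j))%:M : 'M[C]_(degree (FactorU 1))))).
    move=> M /set_mem MD; apply/matrixP => p q; rewrite !ord1 mxE eqxx mulr1n.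
    exact/esym/circle_ofK/diag_entry_unit.
  apply: continuous_subspaceT => M.
  apply: (cvg_mx (nbhs_filter (M : factor_grp C c))) => p q /=.
  rewrite (ord1 p) (ord1 q); under eq_cvg do rewrite mxE eqxx mulr1n.
  rewrite mxE eqxx mulr1n; exact: factor_entry_continuous.
Qed.

End DiagTorus.

Lemma diag_torus_is_torus (C : numClosedFieldType) c :
  is_torus C (@diag_torus C c).
Proof.
have coordC k (j : 'I_k) :
    continuous (fun z : circle_power C k => circle_coord (z j)).
  move=> z; apply: (@continuous_comp _ _ _ (fun z : circle_power C k => z j)
    (@circle_coord C) z); first exact: prod_group_proj_continuous.
  exact: circle_coord_continuous.
case: c => r.
(* SU(0) is separated because it has no last diagonal entry. *)
- case: r => [|r].
    apply: (@coordinates_torus C (FactorSU 0) 0 id (fun u => u)) => //=.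
    by move=> u uU; rewrite det_mx00 eqxx andbT; apply/unitarymxP/matrixP; case.
  (* Determinant 1 forces the last entry to be the inverse of the product of the others, which is
     its conjugate since the modulus is 1. *)
  pose ext (u : 'I_r -> C) (i : 'I_r.+1) : C :=
    if unlift ord_max i is Some j then u j else (\prod_j u j)^*.
  have ext_max u : ext u ord_max = (\prod_j u j)^*.
    by rewrite /ext unlift_none.
  have ext_lift u j : ext u (lift ord_max j) = u j by rewrite /ext liftK.
  have prodE (v : 'I_r.+1 -> C) :
      \prod_i v i = (\prod_j v (lift ord_max j)) * v ord_max.
    rewrite big_ord_recr; congr (_ * _); apply: eq_bigr => j _; congr v.
    by apply: val_inj; rewrite /= /bump leqNgt ltn_ord.
  have prodU (u : 'I_r -> C) : (forall j, u j * (u j)^* = 1) ->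
      (\prod_j u j) * (\prod_j u j)^* = 1.
    by move=> uU; rewrite rmorph_prod -big_split /= big1.
  apply: (@coordinates_torus C (FactorSU r.+1) r (lift ord_max) ext) => //.
  + move=> u v i; rewrite /ext; case: unliftP => //= _.
    by rewrite big_split rmorphM.
  + move=> u uU; apply/andP; split.
      apply: unitary_diag_mx => i; rewrite mxE /ext; case: unliftP => //= _.
      by rewrite conjCK mulrC prodU.
    rewrite det_diag prodE !mxE ext_max (eq_bigr u) ?prodU // => j _.
    by rewrite mxE ext_lift.
  + move=> M i MD; rewrite /ext; case: unliftP => [j ->//|->].
    set p := \prod_j _.
    have pU : p * p^* = 1 by apply: prodU => j; exact: diag_entry_unit.
    have : p * M ord_max ord_max = 1.
      rewrite /p -(prodE (fun i => M i i)).
      have detM : \det (factor_mx M) = 1 by case: (M) => M' /= /andP[_ /eqP].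
      rewrite -[RHS]detM; have /diag_mxP[d ->] := MD.
      by rewrite det_diag; apply: eq_bigr => l _; rewrite mxE eqxx.
    rewrite -pU; apply: mulfI; apply: contra_eq_neq pU => ->.
    by rewrite mul0r eq_sym oner_eq0.
  + move=> i; rewrite /ext; case: unliftP => [j _|_]; first exact: coordC.
    move=> z; apply: (@continuous_comp _ _ _
      (fun z : circle_power C r => \prod_j circle_coord (z j)) Num.conj z).
      have FF := nbhs_filter (z : circle_power C r).
      by apply: (cvg_big mul_continuous FF) => j _; exact: coordC.
    exact: conjC_continuous.
- apply: (@coordinates_torus C (FactorU r) r id (fun u => u)) => //=.
  move=> u uU; apply: unitary_diag_mx => i; rewrite mxE; exact: uU.
- apply: (@coordinates_torus C (FactorSp r) r (lshift r)
    (fun u i =>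
      match fintype.split i with inl j => u j | inr j => (u j)^* end)).
  + by move=> u v i; case: fintype.split => j; rewrite ?rmorphM.
  + move=> u uU; set d := \row_i _.
    have dU : diag_mx d \is unitarymx.
      apply: unitary_diag_mx => i; rewrite mxE; case: fintype.split => j //.
      by rewrite conjCK mulrC.
    apply/andP; split=> //; rewrite sympl_commute // map_diag_mx.
    have -> : d = row_mx (\row_j u j) (\row_j (u j)^*).
      apply/rowP => i; rewrite !mxE; case: split_ordP => j _; by rewrite mxE.
    rewrite map_row_mx !diag_mx_row !mulmx_block.
    rewrite !mul0mx !mulmx0 !mul1mx !mulmx1 !addr0 !add0r mulNmx mulmxN.
    rewrite !mulmx1 !mul1mx; apply/eqP; congr block_mx.
      by congr diag_mx; apply/rowP => j; rewrite !mxE.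
    by congr (- diag_mx _); apply/rowP => j; rewrite !mxE; exact/esym/conjCK.
  + move=> u j; by case: split_ordP => j' /eqP; rewrite eq_shift // => /eqP ->.
  + move=> M i MD; case: split_ordP => j ->//.
    exact: sympl_diag.
  + move=> i; case: fintype.split => j; first exact: coordC.
    move=> z; apply: (@continuous_comp _ _ _ _ Num.conj z); first exact: coordC.
    exact: conjC_continuous.
Qed.

(** * Paths *)

Lemma continuous_within_comp (X Y Z : topologicalType) (A : set X) (B : set Y)
    (f : X -> Y) (g : Y -> Z) :
  continuous f -> (forall x, A x -> B (f x)) -> {within B, continuous g} ->
  {within A, continuous (g \o f)}.
Proof.
move=> fc AB /subspace_continuousP gc; apply/subspace_continuousP => x Ax U gU.
have h := fc x _ (gc (f x) (AB x Ax) U gU).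
change (nbhs x (fun y => A y -> U (g (f y)))).
by apply: filterS (h : nbhs x _) => y /= hy Ay; exact: hy (AB _ Ay).
Qed.

(** * The exponential map from the line onto the circle *)

Section Circle.
Variable R : realType.
Local Notation C := (R[i] : numClosedFieldType).
Local Notation circle := (factor_grp C (FactorU 1)).

Lemma real_complex_continuous : continuous (real_complex R : R -> C).
Proof.
move=> x A /nbhs_ballP[e /= e0 xeA]; apply/nbhs_ballP.
(* Radii of balls in [C] are complex; being positive forces them to be real. *)
have eE : e = (complex.Re e)%:C%C.
  by move: e0; rewrite ltcE /=; case: e {xeA} => a b /= /andP[/eqP -> _].
exists (complex.Re e) => /= [|y]; first by move: e0; rewrite eE ltcR.
rewrite -ball_normE /= => xy; apply: xeA; rewrite -ball_normE /=.
by rewrite -rmorphB normc_def /= expr0n addr0 sqrtr_sqr eE ltcR.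
Qed.

Lemma complex_Re_continuous : continuous (@complex.Re R : C -> R).
Proof.
move=> x A /nbhs_ballP[e /= e0 xeA]; apply/nbhs_ballP.
exists e%:C%C; first by rewrite /= ltcR.
move=> y /= xy; apply: xeA; rewrite -ball_normE /=.
have := le_lt_trans (normc_ge_Re (x - y)) xy.
by rewrite ltcR raddfB.
Qed.

Lemma circle_of_continuous (S : topologicalType) (f : S -> C) :
  (forall s, f s * (f s)^* = 1) -> continuous f ->
  continuous (fun s => circle_of (f s)).
Proof.
move=> fU fc; apply: continuous_comp_initial => s.
apply: (cvg_mx (nbhs_filter s)) => p q /=; rewrite (ord1 p) (ord1 q).
have E : (fun s => circle_coord (circle_of (f s))) = f.
  by apply/funext => t; rewrite circle_ofK.
suff : (fun s => circle_coord (circle_of (f s))) @ s -->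
    circle_coord (circle_of (f s)) by [].
by rewrite E circle_ofK //; exact: fc.
Qed.

Definition circle_exp (t : R) : circle := circle_of (cos t +i* sin t)%C.

Lemma circle_exp_unit (t : R) :
  (cos t +i* sin t)%C * ((cos t +i* sin t)%C)^* = 1 :> C.
Proof.
rewrite -normCK normc_def /= cos2Dsin2 sqrtr1 expr1n.
by [].
Qed.

Lemma circle_expE (t : R) :
  circle_coord (circle_exp t) = (cos t +i* sin t)%C.
Proof. exact: circle_ofK (circle_exp_unit t). Qed.

Lemma circle_coord_inj : injective (@circle_coord C).
Proof. exact: can_inj (@circle_coordK C). Qed.

Lemma circle_expD s t : circle_exp (s + t) = (circle_exp s * circle_exp t)%g.
Proof.
apply: circle_coord_inj.
apply: etrans (circle_expE _) _; apply/esym.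
apply: etrans (circle_coordM _ _) _.
apply: etrans (congr2 *%R (circle_expE s) (circle_expE t)) _.
by rewrite cosD sinD; apply/eqP; rewrite eq_complex /= eqxx addrC eqxx.
Qed.

Lemma circle_exp_continuous : continuous circle_exp.
Proof.
apply: circle_of_continuous; first exact: circle_exp_unit.
have E (s : R) : (cos s)%:C%C + 'i%C * (sin s)%:C%C = (cos s +i* sin s)%C :> C.
  by rewrite [RHS]complexE.
move=> t; rewrite /continuous_at -E; under eq_cvg do rewrite -E.
have cc := continuous_comp (continuous_cos (x := t))
  (@real_complex_continuous (cos t)).
have sc := continuous_comp (continuous_sin (x := t))
  (@real_complex_continuous (sin t)).
exact: cvgD cc (cvgM (cvg_cst _) sc).
Qed.

Lemma circle_exp_surj (z : circle) : exists t, circle_exp t = z.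
Proof.
suff [t tz] : exists t, (cos t +i* sin t)%C = circle_coord z.
  by exists t; apply: circle_coord_inj; rewrite circle_expE.
have := circle_coord_unit z; case: (circle_coord z) => x y.
rewrite -normCK normc_def /= => /eqP.
rewrite -rmorphXn sqr_sqrtr ?addr_ge0 ?sqr_ge0 //.
rewrite -(rmorph1 (real_complex R)) (inj_eq (@complexI _)) => /eqP xy.
have x1 : -1 <= x <= 1 by nra.
have sxy : Num.sqrt (1 - x ^+ 2) = `|y|.
  by rewrite -xy addrAC subrr add0r sqrtr_sqr.
(* [acos x] has the right cosine and the sine [|y|]; the sign of [y] decides the sign of the
   angle. *)
have [y0|y0] := leP 0 y.
  by exists (acos x); rewrite acosK ?sin_acos // sxy ger0_norm.
exists (- acos x); rewrite cosN sinN acosK ?sin_acos // sxy ltr0_norm //.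
by rewrite opprK.
Qed.

Lemma complex_Re_nat n : complex.Re (n%:R : C) = n%:R.
Proof. by rewrite -(rmorph_nat (real_complex R)). Qed.

End Circle.

Lemma within_setT_continuous (X Y : topologicalType) (f : X -> Y) :
  {within setT, continuous f} -> continuous f.
Proof.
move=> /subspace_continuousP fc x U /(fc x I) fU.
by apply: filterS (fU : nbhs x _) => y; exact.
Qed.

Lemma within_eq_continuous (X Y : topologicalType) (A : set X) (f g : X -> Y) :
  (forall x, A x -> f x = g x) ->
  {within A, continuous f} -> {within A, continuous g}.
Proof.
by move=> fg; apply: subspace_eq_continuous => x /set_mem; exact: fg.
Qed.

Section Paths.
Variables (R : realType) (X : topologicalType).
Implicit Types x y z : X.

(** A retraction of the line onto the unit interval: composing with it turns a path continuous on
    the interval into one continuous everywhere. *)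
Definition clamp01 (t : R) : R := (cst 0 \max (id \min cst 1)) t.

Lemma clamp01_continuous : continuous clamp01.
Proof.
apply: max_fun_continuous; first by move=> t; exact: cvg_cst.
by apply: min_fun_continuous => t; [exact: cvg_id|exact: cvg_cst].
Qed.

Lemma clamp01_itv t : `[0, 1]%classic (clamp01 t).
Proof.
by rewrite /= in_itv /= /clamp01 le_max lexx /= ge_max ler01 ge_min lexx orbT.
Qed.

Lemma path_joinedP x y : path_joined R x y <->
  exists gamma : R -> X, [/\ continuous gamma, gamma 0 = x & gamma 1 = y].
Proof.
split=> [[gamma [gc g0 g1]]|[gamma [gc g0 g1]]]; last first.
  by exists gamma; split=> //; exact: continuous_subspaceT.
exists (gamma \o clamp01); split=> /=.
- have := @continuous_within_comp _ _ _ setT _ _ _ clamp01_continuous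
    (fun t _ => clamp01_itv t) gc.
  exact: within_setT_continuous.
- by rewrite /clamp01 /= /Order.min ltr01 /Order.max ltxx.
- by rewrite /clamp01 /= /Order.min ltxx /Order.max ltr01.
Qed.

Lemma path_joined_refl x : path_joined R x x.
Proof.
by apply/path_joinedP; exists (fun=> x); split=> // t; exact: cvg_cst.
Qed.

Lemma path_joined_sym x y : path_joined R x y -> path_joined R y x.
Proof.
move=> /path_joinedP[g [gc g0 g1]]; apply/path_joinedP.
exists (fun t => g (1 - t)); split; rewrite ?subr0 ?subrr // => t.
apply: (@continuous_comp _ _ _ (fun t : R => 1 - t) g t); last exact: gc.
by apply: cvgB; [exact: cvg_cst|exact: cvg_id].
Qed.

Lemma path_joined_trans x y z :
  path_joined R x y -> path_joined R y z -> path_joined R x z.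
Proof.
have n12 : (1 <= 2^-1 :> R) = false by apply/negP => ?; lra.
have d21 : 2 - 1 = 1 :> R by lra.
move=> /path_joinedP[g [gc g0 g1]] /path_joinedP[h [hc h0 h1]].
apply/path_joinedP.
pose k (t : R) := if t <= 2^-1 then g (2 * t) else h (2 * t - 1).
have dc : continuous (fun t : R => 2 * t).
  by move=> t; apply: cvgM; [exact: cvg_cst|exact: cvg_id].
have ec : continuous (fun t : R => 2 * t - 1).
  by move=> t; apply: cvgB; [exact: dc|exact: cvg_cst].
exists k; split.
(* Both half-lines are closed, so continuity is checked on each; the two formulas agree at [2^-1]
   because [g 1 = h 0]. *)
- suff : {within `]-oo, 2^-1] `|` `[2^-1, +oo[, continuous k}.
    have -> : `]-oo, 2^-1] `|` `[2^-1, +oo[ = [set: R].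
      apply/seteqP; split=> // t _; rewrite /= !in_itv /= andbT.
      exact/orP/le_total.
    exact: within_setT_continuous.
  apply: withinU_continuous;
    [exact: interval_closed|exact: interval_closed| |].
  + apply: (@within_eq_continuous _ _ _ (fun t : R => g (2 * t))).
      by move=> t; rewrite /= in_itv /= /k => ->.
    apply: continuous_subspaceT => t.
    exact: (@continuous_comp _ _ _ _ g t (dc t) (gc _)).
  + apply: (@within_eq_continuous _ _ _ (fun t : R => h (2 * t - 1))).
      move=> t; rewrite /= in_itv /= andbT /k => t2.
      case: leP => // t2'; have -> : t = 2^-1 by apply/le_anti/andP.
      by rewrite mulfV // subrr g1 h0.
    apply: continuous_subspaceT => t.
    exact: (@continuous_comp _ _ _ _ h t (ec t) (hc _)).
- by rewrite /k mulr0 invr_ge0 ler0n.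
- by rewrite /k n12 mulr1 d21.
Qed.

Lemma path_component_eq x y :
  path_component R x = path_component R y <-> path_joined R x y.
Proof.
split=> [e|xy].
  have : path_component R y y by exact: path_joined_refl.
  by rewrite -e.
apply/seteqP; split=> z; rewrite /path_component /=;
  last exact: path_joined_trans.
by apply: path_joined_trans; exact: path_joined_sym.
Qed.

End Paths.

Lemma continuous_nat_constant (R : realType) (f : R -> R) :
  continuous f -> (forall t, exists n : nat, f t = n%:R) -> f 0 = f 1.
Proof.
move=> fc fn.
have no_half (p q : nat) (v : R) : v = p%:R + 2^-1 -> v <> q%:R.
  move=> -> e; have : (p.*2.+1)%:R = (q.*2)%:R :> R.
    rewrite -natr1 -!muln2 !natrM -e; lra.
  by move/eqP; rewrite eqr_nat => /eqP /(congr1 odd); rewrite /= !odd_double.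
wlog f01 : f fc fn / f 0 <= f 1.
  move=> H; have [/H|] := leP (f 0) (f 1); first exact.
  move=> /ltW f10.
  have := H (fun t => f (1 - t)); rewrite subr0 subrr => -> // t.
  apply: (@continuous_comp _ _ _ (fun t : R => 1 - t) f t); last exact: fc.
  by apply: cvgB; [exact: cvg_cst|exact: cvg_id].
have [p fp] := fn 0; have [q fq] := fn 1.
move: f01; rewrite fp fq ler_nat leq_eqVlt => /predU1P[->//|pq].
(* If the end values differed, [f] would take the half-integer just above its smaller end value. *)
have [|c _] := @IVT R f 0 1 (p%:R + 2^-1) ler01 (continuous_subspaceT fc).
  rewrite fp fq; have : p.+1%:R <= q%:R :> R by rewrite ler_nat.
  by rewrite -natr1 => h; rewrite ge_min le_max; apply/andP; split; apply/orP;
    [left|right]; lra.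
have [r fr] := fn c => e; by case: (no_half p r _ e fr).
Qed.

(** * The topology on homomorphisms as pointwise convergence *)

Section HomSpace.
Variables (pi : zmodType) (G : topologicalGroupType) (m : nat).
Variables (s : 'I_m -> pi).

Lemma generates_ind (P : pi -> Prop) : generates s ->
  P 0 -> (forall x y, P x -> P y -> P (x + y)) -> (forall x, P x -> P (- x)) ->
  (forall i, P (s i)) -> forall x, P x.
Proof.
move=> hs P0 PD PN Ps x; have [c ->] := hs x.
apply: (big_ind P) => // i _.
have PM y n : P y -> P (y *+ n).
  by move=> Py; elim: n => [|n IHn]; rewrite ?mulr0n // mulrS; exact: PD.
by case: (c i) => n; [exact: PM|exact/PN/PM].
Qed.

Lemma hom0 (f : hom pi G) : f 0 = 1%g.
Proof. by apply: (mulgI (f 0)); rewrite -homD addr0 mulg1. Qed.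

Lemma homN (f : hom pi G) x : f (- x) = (f x)^-1%g.
Proof. by apply: (mulgI (f x)); rewrite -homD subrr hom0 mulgV. Qed.

Lemma mulg_cvg (S : Type) (F : set_system S) (FF : Filter F) (f g : S -> G)
    a b :
  f @ F --> a -> g @ F --> b -> (fun t => (f t * g t)%g) @ F --> (a * b)%g.
Proof.
move=> fa gb.
apply: (@cvg_comp _ _ _ (fun t => (f t, g t)) (fun z : G * G => (z.1 * z.2)%g)
  _ (nbhs (a, b))); last exact: (@mulg_continuous G (a, b)).
exact: cvg_pair.
Qed.

(** Values at sums and opposites are continuous functions of values at generators, so evaluation is
    continuous at every element and the generating set disappears from later arguments. *)
Lemma hom_space_continuousP (S : topologicalType) (gamma : S -> hom pi G) :
  generates s ->
  continuous (gamma : S -> hom_space G s) <->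
  (forall x, continuous (fun t => gamma t x)).
Proof.
move=> hs; split=> gc.
  apply: (generates_ind hs) => [|x y xc yc|x xc|i] t.
  - have -> : (fun t => gamma t 0) = fun=> 1%g.
      by apply/funext => u; rewrite hom0.
    exact: cvg_cst.
  - have -> : (fun t => gamma t (x + y)) = fun t => (gamma t x * gamma t y)%g.
      by apply/funext => u; rewrite homD.
    by apply: mulg_cvg; [exact: xc|exact: yc].
  - have -> : (fun t => gamma t (- x)) = fun t => ((gamma t x)^-1)%g.
      by apply/funext => u; rewrite homN.
    apply: (@continuous_comp _ _ _ (fun t => gamma t x)
      (fun g : G => g^-1%g) t).
      exact: xc.
    exact: invg_continuous.
  - apply: (@continuous_comp _ _ _ (gamma : S -> hom_space G s)
      (fun f : hom_space G s => (f : hom pi G) (s i)) t); first exact: gc.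
    apply: (@continuous_comp _ _ _ (hom_eval s : hom_space G s -> _)
      (fun z : prod_group (fun _ : 'I_m => G) => z i)).
      exact: initial_continuous.
    exact: prod_group_proj_continuous.
apply: continuous_comp_initial.
apply: (@prod_group_continuous _ (fun _ : 'I_m => G)) => i; exact: gc.
Qed.

End HomSpace.

(** * Components of the space of homomorphisms *)

Lemma card_eq_image (S X Y : Type) (D : set S) (p : S -> set X)
    (q : S -> set Y) :
  (forall a b, D a -> D b -> p a = p b <-> q a = q b) ->
  (p @` D #= q @` D)%card.
Proof.
move=> pq; apply/card_set_bijP.
(* The map sends [p a] to [q a]; equality of the fibres of [p] and [q] makes it well defined and
   injective. *)
pose f u := xget point [set w | exists2 a, D a & p a = u /\ q a = w].
have fp a : D a -> f (p a) = q a.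
  move=> Da; rewrite /f; case: xgetP => [w -> [b Db [ba <-]]|].
    by apply/pq.
  by move=> /(_ (q a))[]; exists a.
exists f; split=> [_ [a Da <-]|_ _ /set_mem[a Da <-] /set_mem[b Db <-]|
    _ [a Da <-]].
- by rewrite fp //; exists a.
- by rewrite !fp // => /pq; exact.
- by exists (p a); [exists a|exact: fp].
Qed.

Section Normaliser.
Variables (G : topologicalGroupType) (T : set G).

Lemma conjsM (g h : G) (S : set G) : conjs S (g * h)%g = conjs (conjs S h) g.
Proof.
apply/seteqP; split=> [_ [t St <-]|_ [_ [t St <-] <-]].
  by exists (h * t * h^-1)%g; [exists t|rewrite invgM !mulgA].
by exists t => //; rewrite invgM !mulgA.
Qed.

Lemma conjs1 (S : set G) : conjs S 1%g = S.
Proof.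
apply/seteqP; split=> [_ [t St <-]|t St]; first by rewrite mul1g invg1 mulg1.
by exists t; rewrite // mul1g invg1 mulg1.
Qed.

Lemma normaliser1 : normaliser T 1%g.
Proof. exact: conjs1. Qed.

Lemma normaliserM g h :
  normaliser T g -> normaliser T h -> normaliser T (g * h)%g.
Proof. by rewrite /normaliser /= conjsM => gT ->. Qed.

Lemma normaliserV g : normaliser T g -> normaliser T (g^-1)%g.
Proof.
by move=> gT; rewrite /normaliser /= -[X in conjs X _]gT -conjsM mulVg conjs1.
Qed.

Variable B : zmodType.

Lemma conj_homM (g h : G) (f : hom B G) :
  conj_hom (g * h)%g f = conj_hom g (conj_hom h f).
Proof. by apply: hom_eq => a /=; rewrite invgM !mulgA. Qed.

Lemma conj_hom1 (f : hom B G) : conj_hom 1%g f = f.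
Proof. by apply: hom_eq => a /=; rewrite mul1g invg1 mulg1. Qed.

Lemma conj_homK (g : G) (f : hom B G) : conj_hom (g^-1)%g (conj_hom g f) = f.
Proof. by rewrite -conj_homM mulVg conj_hom1. Qed.

Variables (C : numClosedFieldType) (torT : is_torus C T).

(** Trades cosets for elements of the normaliser, which removes the choice of representative made in
    [weyl_act]. *)
Lemma weyl_orbitE (f : hom B G) : hom_into T f ->
  weyl_orbit T f = [set conj_hom g f | g in normaliser T].
Proof.
move=> fT; apply/seteqP; split=> [_ [_ [g gT <-] <-]|_ [g gT <-]].
  by exists g => //; rewrite (weyl_actE _ torT fT).
by exists (lcoset T g); [exists g|rewrite (weyl_actE _ torT fT)].
Qed.

Lemma weyl_orbit_eq (f f' : hom B G) : hom_into T f -> hom_into T f' ->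
  weyl_orbit T f = weyl_orbit T f' <->
  exists2 w, normaliser T w & conj_hom w f = f'.
Proof.
move=> fT f'T; rewrite !weyl_orbitE //; split=> [e|[w wN <-]].
  have : [set conj_hom g f' | g in normaliser T] f'.
    by exists 1%g; [exact: normaliser1|exact: conj_hom1].
  by rewrite -e.
apply/seteqP; split=> _ [g gN <-].
  exists (g * w^-1)%g; last by rewrite conj_homM conj_homK.
  by apply: normaliserM => //; exact: normaliserV.
by exists (g * w)%g; [exact: normaliserM|rewrite conj_homM].
Qed.

End Normaliser.

(** * Reduction to a torus that absorbs commuting sets and is rigid along paths *)

Section Components.
Variables (R : realType) (C : numClosedFieldType).
Variable cexp : R -> factor_grp C (FactorU 1).
Hypothesis cexpD : forall s t, cexp (s + t) = (cexp s * cexp t)%g.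
Hypothesis cexp_continuous : continuous cexp.
Hypothesis cexp_surj : forall z, exists t, cexp t = z.

Variables (G : topologicalGroupType) (T : set G).
Hypothesis torT : is_torus C T.
Hypothesis conjT : forall S : set G,
  (forall x y, S x -> S y -> (x * y = y * x)%g) ->
  exists g, forall x, S x -> T (g * x * g^-1)%g.

Variables (n : nat) (A : finZmodType).
Hypothesis weylT : forall (f f' : hom A G) (gamma : R -> hom A G),
  hom_into T f -> hom_into T f' ->
  (forall a, continuous (fun t => gamma t a)) -> gamma 0 = f -> gamma 1 = f' ->
  exists2 w, normaliser T w & conj_hom w f = f'.

Local Notation pi := ('rV[int]_n * A)%type.

Variables (m : nat) (s : 'I_m -> pi).
Hypothesis hs : generates s.

Local Notation X := (hom_space G s).

Lemma hom_path_joinedP (F F' : hom pi G) : path_joined R (F : X) (F' : X) <->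
  exists gamma : R -> hom pi G,
    [/\ forall x, continuous (fun t => gamma t x), gamma 0 = F & gamma 1 = F'].
Proof.
rewrite path_joinedP; split=> -[gamma [gc g0 g1]]; exists gamma; split=> //.
  by apply/(hom_space_continuousP gamma hs).
by apply/(hom_space_continuousP gamma hs).
Qed.

Lemma cexp0 : cexp 0 = 1%g.
Proof. by apply: (mulgI (cexp 0)); rewrite -cexpD addr0 mulg1. Qed.

Definition cexp_scale k (theta : 'I_k -> R) (t : R) : circle_power C k :=
  fun j => cexp (t * theta j).

Lemma cexp_scale_continuous k (theta : 'I_k -> R) :
  continuous (cexp_scale theta).
Proof.
apply: prod_group_continuous => j t.
apply: (@continuous_comp _ _ _ (fun t : R => t * theta j) cexp t);
  last exact: cexp_continuous.
by apply: cvgM; [exact: cvg_id|exact: cvg_cst].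
Qed.

Lemma cexp_scale0 k (theta : 'I_k -> R) : cexp_scale theta 0 = 1%g.
Proof.
by apply/functional_extensionality_dep => j; rewrite /cexp_scale mul0r cexp0.
Qed.

Fact hom_ext_homD (f : hom A G) (x y : pi) :
  f (x + y).2 = (f x.2 * f y.2)%g.
Proof. exact: homD. Qed.

Definition hom_ext (f : hom A G) : hom pi G := Hom (hom_ext_homD f).

Fact hom_res_homD (F : hom pi G) (a b : A) :
  F (0, a + b) = (F (0%R, a) * F (0%R, b))%g.
Proof. by rewrite -homD; congr (F (_, _)); rewrite addr0. Qed.

Definition hom_res (F : hom pi G) : hom A G := Hom (hom_res_homD F).

(** A single element is a commuting family, so it is conjugate into [T]; there its angles are scaled
    to 0 and the path is conjugated back. *)
Lemma group_path (g : G) :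
  exists p : R -> G, [/\ continuous p, p 0 = 1%g & p 1 = g].
Proof.
have [h hg] : exists h, T (h * g * h^-1)%g.
  have [|h hP] := conjT (S := [set g]); first by move=> x y -> ->.
  by exists h; exact: hP.
have [k [phi [psi [phiM phiT _ phic _]]]] := torT.
have phi1 : phi 1%g = 1%g by apply: (mulgI (phi 1%g)); rewrite -phiM !mulg1.
move: hg; rewrite -phiT => -[z _ zg].
have [theta thetaE] := choice (fun j => cexp_surj (z j)).
exists (fun t => h^-1 * phi (cexp_scale theta t) * h)%g; split.
- move=> t; apply: mulg_cvg; last exact: cvg_cst.
  apply: mulg_cvg; first exact: cvg_cst.
  apply: (@continuous_comp _ _ _ (fun t => cexp_scale theta t) phi t);
    last exact: phic.
  exact: cexp_scale_continuous.
- by rewrite cexp_scale0 phi1 mulg1 mulVg.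
- have -> : cexp_scale theta 1 = z.
    by apply/functional_extensionality_dep => j; rewrite /cexp_scale mul1r.
  by rewrite zg !mulgA mulVg mul1g mulgVK.
Qed.

Lemma conj_hom_joined (g : G) (F : hom pi G) :
  path_joined R (F : X) (conj_hom g F : X).
Proof.
have [p [pc p0 p1]] := group_path g.
apply/hom_path_joinedP; exists (fun t => conj_hom (p t) F).
split; rewrite ?p0 ?p1 ?conj_hom1 // => x t /=.
apply: mulg_cvg.
  by apply: mulg_cvg; [exact: pc|exact: cvg_cst].
apply: (@continuous_comp _ _ _ p (fun g : G => g^-1%g) t); first exact: pc.
exact: invg_continuous.
Qed.

Lemma torus_hom_joined (F : hom pi G) : (forall x, T (F x)) ->
  path_joined R (F : X) (hom_ext (hom_res F) : X).
Proof.
move=> FT; apply: path_joined_sym; apply/hom_path_joinedP.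
have TC x y : T x -> T y -> (x * y = y * x)%g by exact: torus_abelian torT.
have [k [phi [psi [phiM phiT _ phic _]]]] := torT.
have phi1 : phi 1%g = 1%g by apply: (mulgI (phi 1%g)); rewrite -phiM !mulg1.
have /choice[theta thetaE] (l : 'I_n) : exists th : 'I_k -> R,
    phi (fun j => cexp (th j)) = F (delta_mx 0 l, 0).
  have := FT (delta_mx 0 l, 0); rewrite -phiT => -[z _ zF].
  have [th thE] := choice (fun j => cexp_surj (z j)).
  exists th; rewrite -zF; congr phi; apply/functional_extensionality_dep => j.
  exact: thE.
(* Angles are chosen only on the standard basis and extended additively, so that scaling them by any
   real [t] still gives a homomorphism. Lifting each value separately would lose additivity. *)
pose L (v : 'rV[int]_n) j : R := \sum_l theta l j *~ v 0 l.
have LD v w j : L (v + w) j = L v j + L w j.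
  by rewrite -big_split; apply: eq_bigr => l _; rewrite mxE mulrzDr.
pose K t v := phi (cexp_scale (L v) t).
have KD t v w : K t (v + w) = (K t v * K t w)%g.
  rewrite -phiM; congr phi; apply/functional_extensionality_dep => j.
  by rewrite /cexp_scale LD mulrDr cexpD.
have KT t v : T (K t v) by rewrite -phiT; exists (cexp_scale (L v) t).
have gammaD t (x y : pi) :
    (K t (x + y).1 * F (0, (x + y).2) =
    (K t x.1 * F (0, x.2)) * (K t y.1 * F (0, y.2)))%g.
  rewrite /= KD (hom_res_homD F) !mulgA; congr (_ * _)%g; rewrite -!mulgA.
  by congr (_ * _)%g; exact: TC.
exists (fun t => Hom (gammaD t)); split.
- move=> x t; apply: mulg_cvg; last exact: cvg_cst.
  apply: (@continuous_comp _ _ _ (fun t => cexp_scale (L x.1) t) phi t);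
    last exact: phic.
  exact: cexp_scale_continuous.
- by apply: hom_eq => x; rewrite /= /K cexp_scale0 phi1 mul1g.
- apply: hom_eq => -[v a] /=.
  have -> : F (v, a) = (F (v, 0%R) * F (0%R, a))%g.
    by rewrite -homD; congr (F (_, _)); rewrite ?addr0 ?add0r.
  congr (_ * _)%g; pose Kh : hom 'rV[int]_n G := Hom (KD 1).
  have FD (u w : 'rV[int]_n) : F (u + w, 0) = (F (u, 0%R) * F (w, 0%R))%g.
    by rewrite -homD; congr (F (_, _)); rewrite addr0.
  pose Fh : hom 'rV[int]_n G := Hom FD.
  rewrite -/(Kh v) -/(Fh v); move: v.
  (* [K 1] and the restriction of [F] to the free part are homomorphisms that agree on the standard
     basis by the choice of [theta]. *)
  have gen : generates (fun l : 'I_n => delta_mx 0 l : 'rV[int]_n).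
    move=> v; exists (fun l => v 0 l); rewrite [LHS]row_sum_delta.
    by apply: eq_bigr => l _; rewrite -scaler_int intz.
  apply: (@generates_ind _ _ _ (fun v => Kh v = Fh v) gen) =>
    [|x y xE yE|x xE|l].
  + exact: etrans (hom0 Kh) (esym (hom0 Fh)).
  + by rewrite (homD Kh) (homD Fh) xE yE.
  + by rewrite (homN Kh) (homN Fh) xE.
  + rewrite /= -thetaE /K; congr phi; apply/functional_extensionality_dep => j.
    rewrite /cexp_scale mul1r /L (bigD1 l) //= big1 ?addr0 ?mxE ?eqxx //.
    move=> l' ll'.
    by rewrite mxE (negPf ll') andbF mulr0z.
Qed.

(** The image of the abelian group is a commuting family. Conjugating it into [T] stays in the
    component of [F], and so does killing the free part. *)
Lemma hom_joined_torus (F : hom pi G) :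
  exists2 f : hom A G, hom_into T f & path_joined R (F : X) (hom_ext f : X).
Proof.
have [|g gT] := conjT (S := range F).
  by move=> _ _ [x _ <-] [y _ <-]; rewrite -!homD addrC.
have gF x : T (conj_hom g F x) by apply: gT; exists x.
exists (hom_res (conj_hom g F)); first by move=> a; exact: gF.
exact: path_joined_trans (conj_hom_joined g F) (torus_hom_joined gF).
Qed.

Lemma hom_ext_joined (f f' : hom A G) : hom_into T f -> hom_into T f' ->
  path_joined R (hom_ext f : X) (hom_ext f' : X) <->
  exists2 w, normaliser T w & conj_hom w f = f'.
Proof.
move=> fT f'T; split=> [/hom_path_joinedP[gamma [gc g0 g1]]|[w wN <-]].
  apply: (@weylT f f' (fun t => hom_res (gamma t))) => //.
  - by move=> a; exact: gc.
  - by apply: hom_eq => a; rewrite /= g0.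
  - by apply: hom_eq => a; rewrite /= g1.
have -> : hom_ext (conj_hom w f) = conj_hom w (hom_ext f) by exact: hom_eq.
exact: conj_hom_joined.
Qed.

Lemma path_components_weyl_orbits :
  (path_components R X #= weyl_orbits T A)%card.
Proof.
have -> : path_components R X =
    [set path_component R (hom_ext f : X) | f in @hom_into G T A].
  apply/seteqP; split=> [_ [F _ <-]|_ [f _ <-]]; last by exists (hom_ext f).
  have [f fT Ff] := hom_joined_torus F.
  by exists f => //; apply/esym/path_component_eq.
(* Both sides are now images of [hom_into T], and two homomorphisms are identified on either side
   exactly when the normaliser conjugates one into the other. *)
apply: card_eq_image => f f' fT f'T.
rewrite path_component_eq hom_ext_joined //.
exact: iff_sym (weyl_orbit_eq torT fT f'T).
Qed.

End Components.

(** * Products and conjugates of tori *)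

Lemma prod_torus (C : numClosedFieldType) (I : finType)
    (G : I -> topologicalGroupType) (T : forall i, set (G i)) :
  (forall i, is_torus C (T i)) ->
  is_torus C ([set x | forall i, T i (x i)] : set (prod_group G)).
Proof.
move=> torT.
(* The ranks are chosen first because the types of [phi] and [psi] depend on them. *)
have [k kP] : exists k : I -> nat, forall i,
    exists (phi : circle_power C (k i) -> G i)
      (psi : G i -> circle_power C (k i)),
    [/\ (forall x y, phi (x * y)%g = (phi x * phi y)%g), range phi = T i,
        cancel phi psi, continuous phi & {within T i, continuous psi}].
  by exists (fun i => projT1 (cid (torT i))) => i; exact: projT2 (cid (torT i)).
pose phi i := projT1 (cid (kP i)).
pose psi i := projT1 (cid (projT2 (cid (kP i)))).
have H i : [/\ (forall x y, phi i (x * y)%g = (phi i x * phi i y)%g),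
    range (phi i) = T i, cancel (phi i) (psi i), continuous (phi i) &
    {within T i, continuous (psi i)}].
  exact: projT2 (cid (projT2 (cid (kP i)))).
(* Circle coordinates of the product are indexed by the disjoint union of the coordinate sets of the
   factors, enumerated to obtain an ordinal. *)
pose K := {: {i : I & 'I_(k i)}}.
pose split_coord (z : circle_power C #|K|) i : circle_power C (k i) :=
  fun j => z (enum_rank (Tagged (fun i => 'I_(k i)) j : K)).
pose join_coord (u : forall i, circle_power C (k i)) : circle_power C #|K| :=
  fun r => u (tag (enum_val r : K)) (tagged (enum_val r : K)).
have join_coordK u : split_coord (join_coord u) = u.
  apply/functional_extensionality_dep => i.
  apply/functional_extensionality_dep => j.
  by rewrite /split_coord /join_coord enum_rankK.
have split_coordK z : join_coord (split_coord z) = z.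
  apply/functional_extensionality_dep => r; rewrite /split_coord /join_coord.
  by congr z; rewrite -[RHS]enum_valK; congr enum_rank; case: (enum_val r).
exists #|K|, (fun z i => phi i (split_coord z i)),
  (fun x => join_coord (fun i => psi i (x i))); split.
- move=> x y; apply/functional_extensionality_dep => i.
  have [phiM _ _ _ _] := H i.
  exact: (phiM (split_coord x i) (split_coord y i)).
- apply/seteqP; split=> [_ [z _ <-] i|x xT].
    by have [_ <- _ _ _] := H i; exists (split_coord z i).
  have [u uE] : exists u : forall i, circle_power C (k i),
      forall i, phi i (u i) = x i.
    have xP i : exists u, phi i u = x i.
      have [_ phiT _ _ _] := H i.
      by move: (xT i); rewrite -phiT => -[u _ uE]; exists u.
    by exists (fun i => projT1 (cid (xP i))) => i; exact: projT2 (cid (xP i)).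
  exists (join_coord u) => //; apply/functional_extensionality_dep => i.
  by rewrite join_coordK uE.
- move=> z; rewrite -[RHS]split_coordK; congr join_coord.
  apply/functional_extensionality_dep => i.
  by have [_ _ phiK _ _] := H i; rewrite phiK.
- apply: prod_group_continuous => i z.
  apply: (@continuous_comp _ _ _ (fun z => split_coord z i) (phi i) z).
    move: z; apply: prod_group_continuous => j.
    exact: prod_group_proj_continuous.
  by have [_ _ _ phic _] := H i; exact: phic.
- apply: prod_group_continuous => r.
  pose i := tag (enum_val r : K); pose j : 'I_(k i) := tagged (enum_val r : K).
  have [_ _ _ _ psic] := H i.
  apply: (@continuous_within_comp _ _ _ _ (T i) (fun x : prod_group G => x i)
    (fun y : G i => psi i y j)).
  + exact: prod_group_proj_continuous.
  + by move=> x; exact.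
  + move=> y; apply: (@continuous_comp _ _ _ (psi i : subspace (T i) -> _)
      (fun u : circle_power C (k i) => u j) y); first exact: psic.
    exact: prod_group_proj_continuous.
Qed.

Lemma conjg_continuous (G : topologicalGroupType) (g : G) :
  continuous (fun x : G => (g * x * g^-1)%g).
Proof.
move=> x; apply: mulg_cvg; last exact: cvg_cst.
by apply: mulg_cvg; [exact: cvg_cst|exact: cvg_id].
Qed.

Lemma conjs_torus (C : numClosedFieldType) (G : topologicalGroupType)
    (T : set G) (g : G) : is_torus C T -> is_torus C (conjs T g).
Proof.
move=> [k [phi [psi [phiM phiT phiK phic psic]]]].
exists k, (fun z => g * phi z * g^-1)%g, (fun x => psi (g^-1 * x * g)%g); split.
- by move=> x y; rewrite phiM !mulgA mulgVK.
- apply/seteqP; split=> [_ [z _ <-]|_ [t + <-]].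
    by exists (phi z) => //; rewrite -phiT; exists z.
  by rewrite -phiT => -[z _ <-]; exists z.
- by move=> z; rewrite !mulgA mulVg mul1g mulgVK phiK.
- move=> z.
  apply: (@continuous_comp _ _ _ phi (fun x : G => (g * x * g^-1)%g) z).
    exact: phic.
  exact: conjg_continuous.
- apply: (@continuous_within_comp _ _ _ _ T
    (fun x : G => (g^-1 * x * g)%g) psi) => //.
    by have := @conjg_continuous G (g^-1)%g; rewrite invgK.
  by move=> _ [t Tt <-]; rewrite !mulgA mulVg mul1g mulgVK.
Qed.

(** * Constancy of multiplicities along a path *)

Section FactorPath.
Variables (R : realType) (C : numClosedFieldType) (re : C -> R).
Hypothesis re_continuous : continuous re.
Hypothesis re_nat : forall n : nat, re n%:R = n%:R.
Variables (A : finZmodType) (c : classical_type).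
Local Notation D := (@diag_torus C c).

Lemma multiplicity_continuous (x : {ffun A -> C})
    (gamma : R -> hom A (factor_grp C c)) :
  (forall a, continuous (fun t => gamma t a)) ->
  continuous (fun t => multiplicity x (fun a => factor_mx (gamma t a))).
Proof.
move=> gc t; rewrite /multiplicity; apply: cvgM; first exact: cvg_cst.
apply: (cvg_big add_continuous) => a _; apply: cvgM; first exact: cvg_cst.
rewrite /mxtrace; apply: (cvg_big add_continuous) => i _.
apply: (@continuous_comp _ _ _ (fun t => gamma t a)
  (fun M : factor_grp C c => M i i) t); first exact: gc.
exact: factor_entry_continuous.
Qed.

(** The image of [f] commutes, so a conjugate of [f] is diagonal, and multiplicities are invariant
    under conjugation. *)
Lemma multiplicity_nat (f : hom A (factor_grp C c)) x : unit_character x ->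
  exists n : nat, multiplicity x (fun a => factor_mx (f a)) = n%:R.
Proof.
move=> xC; have [|g gD] := @factor_codiagonalization C c (range f).
  by move=> _ _ [a _ <-] [b _ <-]; rewrite -!homD addrC.
have fD : hom_into D (conj_hom g f) by move=> a; apply: gD; exists a.
rewrite -(multiplicity_conj _ _ (factor_unitary g)).
have -> : (fun a => factor_mx g *m factor_mx (f a) *m (factor_mx g)^t*) =
  (fun a => factor_mx (conj_hom g f a)) by [].
rewrite multiplicity_diag //; first by eexists.
by move=> i; exact: diag_hom_character.
Qed.

Lemma factor_weyl_path (gamma : R -> hom A (factor_grp C c)) :
  (forall a, continuous (fun t => gamma t a)) ->
  hom_into D (gamma 0) -> hom_into D (gamma 1) ->
  exists2 w, normaliser D w & conj_hom w (gamma 0) = gamma 1.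
Proof.
move=> gc g0D g1D.
have perm01 : perm_eq (diag_characters (fun a => factor_mx (gamma 1 a)))
    (diag_characters (fun a => factor_mx (gamma 0 a))).
  apply: diag_characters_perm_eq => [i|i|x xC]; try exact: diag_hom_character.
  pose mu t := multiplicity x (fun a => factor_mx (gamma t a)).
  have muN t : exists n : nat, mu t = n%:R by exact: multiplicity_nat.
  (* The intermediate value theorem needs a real function, and [re] is injective on natural
     numbers. *)
  suff : re (mu 1) = re (mu 0).
    have [p] := muN 0; have [q] := muN 1; rewrite /mu => -> ->.
    by rewrite !re_nat => /eqP; rewrite eqr_nat => /eqP ->.
  apply/esym; apply: (@continuous_nat_constant R (fun t => re (mu t))) => t.
    apply: (@continuous_comp _ _ _ mu re t); last exact: re_continuous.
    exact: multiplicity_continuous.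
  by have [p ->] := muN t; exists p; rewrite re_nat.
move: perm01 g0D g1D; case: c gamma gc => k gamma _ perm01 g0D g1D.
- exact: weyl_conj_SU.
- exact: weyl_conj_U.
- exact: weyl_conj_Sp.
Qed.

End FactorPath.

Section DiagonalProduct.
Variables (C : numClosedFieldType) (I : finType) (F : I -> classical_type).
Local Notation G := (classical_product C F).

Definition diag_product : set G := [set x | forall i, diag_torus (x i)].

Lemma diag_product_torus : is_torus C diag_product.
Proof. exact: (prod_torus (fun i => @diag_torus_is_torus C (F i))). Qed.

Lemma product_codiagonalization (S : set G) :
  (forall x y, S x -> S y -> (x * y = y * x)%g) ->
  exists g, forall x, S x -> diag_product (g * x * g^-1)%g.
Proof.
move=> SC.
have gP i : exists g : factor_grp C (F i),
    forall x, [set y i | y in S] x -> diag_torus (g * x * g^-1)%g.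
  apply: factor_codiagonalization => _ _ [y Sy <-] [z Sz <-].
  exact: (congr1 (fun u : G => u i) (SC y z Sy Sz)).
exists (fun i => projT1 (cid (gP i))) => x Sx i.
by apply: (projT2 (cid (gP i))); exists x.
Qed.

Variables (R : realType) (re : C -> R).
Hypothesis re_continuous : continuous re.
Hypothesis re_nat : forall n : nat, re n%:R = n%:R.
Variable A : finZmodType.

Lemma product_weyl_path (gamma : R -> hom A G) :
  (forall a, continuous (fun t => gamma t a)) ->
  hom_into diag_product (gamma 0) -> hom_into diag_product (gamma 1) ->
  exists2 w, normaliser diag_product w & conj_hom w (gamma 0) = gamma 1.
Proof.
move=> gc g0D g1D.
have homDi (f : hom A G) i a b : f (a + b) i = (f a i * f b i)%g.
  by rewrite homD.
pose g_ i t : hom A (factor_grp C (F i)) := Hom (homDi (gamma t) i).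
have wP i : exists2 w, normaliser (@diag_torus C (F i)) w &
    conj_hom w (g_ i 0) = g_ i 1.
  apply: (factor_weyl_path re_continuous re_nat) => [a t|a|a].
  - apply: (@continuous_comp _ _ _ (fun t => gamma t a) (fun x : G => x i) t).
      exact: gc.
    exact: prod_group_proj_continuous.
  - exact: g0D.
  - exact: g1D.
pose w : G := fun i => projT1 (cid2 (wP i)).
have wN i : normaliser (@diag_torus C (F i)) (w i) by rewrite /w; case: cid2.
have wg i : conj_hom (w i) (g_ i 0) = g_ i 1 by rewrite /w; case: cid2.
exists w.
  apply: normaliserP => t tD i.
    by have <- := wN i; exists (t i) => //; exact: tD.
  have <- := normaliserV (wN i); exists (t i); first exact: tD.
  by rewrite invgK.
apply: hom_eq => a; apply/functional_extensionality_dep => i.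
exact: (congr1 (fun f : hom A _ => f a) (wg i)).
Qed.

End DiagonalProduct.

(** * Maximal tori as conjugates of the diagonal torus *)

Section MaximalTorus.
Variables (C : numClosedFieldType) (G : topologicalGroupType) (D T : set G).
Hypothesis torD : is_torus C D.
Hypothesis conjD : forall S : set G,
  (forall x y, S x -> S y -> (x * y = y * x)%g) ->
  exists g, forall x, S x -> D (g * x * g^-1)%g.

(** A torus is abelian, so some [g] conjugates [T] into [D]. Then [T] lies in the torus
    [conjs D (g^-1)], and maximality gives equality. *)
Lemma maximal_torus_conj : maximal_torus C T -> exists g, T = conjs D g.
Proof.
move=> [torT maxT]; have [|g gD] := conjD (S := T).
  by move=> x y; exact: torus_abelian torT.
exists (g^-1)%g; apply/esym/maxT; first exact: conjs_torus.
move=> x Tx; exists (g * x * g^-1)%g; first exact: gD.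
by rewrite invgK !mulgA mulVg mul1g mulgVK.
Qed.

Lemma conjs_commuting (g : G) (S : set G) :
  (forall x y, S x -> S y -> (x * y = y * x)%g) ->
  exists h, forall x, S x -> conjs D g (h * x * h^-1)%g.
Proof.
move=> /conjD[h hD]; exists (g * h)%g => x Sx.
by exists (h * x * h^-1)%g; [exact: hD|rewrite invgM !mulgA].
Qed.

Lemma normaliser_conjs (g w : G) :
  normaliser D w -> normaliser (conjs D g) (g * w * g^-1)%g.
Proof.
by move=> wD; rewrite /normaliser /= -!conjsM mulgVK conjsM wD.
Qed.

Lemma conjs_weyl_path (R : realType) (A : finZmodType) (g : G) :
  (forall gamma : R -> hom A G,
    (forall a, continuous (fun t => gamma t a)) ->
    hom_into D (gamma 0) -> hom_into D (gamma 1) ->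
    exists2 w, normaliser D w & conj_hom w (gamma 0) = gamma 1) ->
  forall (f f' : hom A G) (gamma : R -> hom A G),
    hom_into (conjs D g) f -> hom_into (conjs D g) f' ->
    (forall a, continuous (fun t => gamma t a)) ->
    gamma 0 = f -> gamma 1 = f' ->
    exists2 w, normaliser (conjs D g) w & conj_hom w f = f'.
Proof.
move=> weylD f f' gamma fD f'D gc g0 g1.
have intoD (h : hom A G) : hom_into (conjs D g) h ->
    hom_into D (conj_hom (g^-1)%g h).
  move=> hD a; have [t Dt] := hD a; rewrite /= => <-.
  by rewrite invgK !mulgA mulVg mul1g mulgVK.
(* The path is moved back to [D] by [g^-1]; the element found there is then conjugated by [g] to
   normalise [conjs D g]. *)
have [a t|||w wN wf] := weylD (fun t => conj_hom (g^-1)%g (gamma t)).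
- apply: (@continuous_comp _ _ _ (fun t => gamma t a)
    (fun x : G => (g^-1 * x * g^-1^-1)%g) t); first exact: gc.
  exact: conjg_continuous.
- by rewrite g0; exact: intoD.
- by rewrite g1; exact: intoD.
exists (g * w * g^-1)%g; first exact: normaliser_conjs.
rewrite g0 g1 in wf; rewrite !conj_homM wf.
by rewrite -conj_homM mulgV conj_hom1.
Qed.

End MaximalTorus.

Theorem corollary3p4 (R : realType) (I : finType) (F : I -> classical_type)
    (T : set (classical_product R[i] F)) (hT : maximal_torus R[i] T)
    (n : nat) (A : finZmodType)
    (m : nat) (s : 'I_m -> ('rV[int]_n * A)%type) (hs : generates s) :
  (path_components R (hom_space (classical_product R[i] F) s)
     #= weyl_orbits T A)%card.
Proof.
have [g TE] := maximal_torus_conj (diag_product_torus R[i] F)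
  (@product_codiagonalization R[i] I F) hT.
(* What remains is conjugacy of commuting sets and rigidity along paths for [T]; both are carried
   over from the diagonal torus by [g]. *)
apply: (path_components_weyl_orbits (@circle_expD R) (@circle_exp_continuous R)
  (@circle_exp_surj R) hT.1 _ _ hs).
- rewrite TE; exact: conjs_commuting (@product_codiagonalization R[i] I F) g.
- rewrite TE; apply: conjs_weyl_path.
  exact: product_weyl_path (@complex_Re_continuous R) (@complex_Re_nat R) A.
Qed.
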